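(* For each $\alpha\in(0,2]$, the Linnik distribution with parameter $\alpha$ is the scale mixture of Laplace laws in which the random scale is the square root of the ratio of two independent random variables having one and the same one-sided strictly stable distribution with characteristic exponent $\alpha/2$. That is, if $L_\alpha$ has the Linnik distribution with parameter $\alpha$, $\Lambda$ has the Laplace distribution with density $\frac12 e^{-|x|}$, $x\in\mathbb{R}$, $S_{\alpha/2,1}$ and $S'_{\alpha/2,1}$ both have the one-sided strictly stable distribution with characteristic exponent $\alpha/2$, and $\Lambda$, $S_{\alpha/2,1}$, $S'_{\alpha/2,1}$ are independent, then $$L_{\alpha}\stackrel{d}{=} \Lambda\sqrt{\frac{S_{\alpha/2,1}}{S'_{\alpha/2,1}}}.$$
   Context: The symbol $\stackrel{d}{=}$ denotes equality of distributions. Linnik distribution with parameter $\alpha\in(0,2]$: the probability distribution on $\mathbb{R}$ with characteristic function $t\mapsto \frac{1}{1+|t|^{\alpha}}$, $t\in\mathbb{R}$. One-sided strictly stable distribution with characteristic exponent $\beta\in(0,1]$: the distribution with characteristic function $t\mapsto\exp\{-|t|^{\beta}\exp\{-\frac12 i\pi\beta\,\mathrm{sign}\,t\}\}$, $t\in\mathbb{R}$; $S_{\beta,1}$ denotes a random variable with this distribution. It is concentrated on $(0,\infty)$ and equivalently is determined by the Laplace transform $\mathsf{E}e^{-sS_{\beta,1}}=e^{-s^{\beta}}$, $s\ge0$ (for $\beta=1$ it is the unit mass at $1$). *)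

(* Defs.v *)
(* MathComp / MathComp-Analysis. *)
From HB Require Import structures.
From mathcomp Require Import all_boot all_order all_algebra.
From mathcomp Require Import all_classical all_reals all_analysis.
From mathcomp Require Import measurable_realfun complex.

Set Implicit Arguments.
Unset Strict Implicit.
Unset Printing Implicit Defensive.

Import Order.TTheory GRing.Theory Num.Theory.
Import numFieldNormedType.Exports.

Local Open Scope classical_set_scope.
Local Open Scope ring_scope.
Local Open Scope complex_scope.

Definition cexp (R : realType) (z : R[i]) : R[i] :=
  (expR (complex.Re z) * cos (complex.Im z)) +i* (expR (complex.Re z) * sin (complex.Im z)).

(* The integral of x |-> exp(itx), taken componentwise; for a probability
   measure mu the integrands are bounded, so both integrals are finite. *)
Definition char_fun (R : realType) (mu : probability R R) (t : R) : R[i] :=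
  (\int[mu]_x cos (t * x)) +i* (\int[mu]_x sin (t * x)).

Definition linnik_law (R : realType) (alpha : R) (mu : probability R R) :=
  forall t : R, char_fun mu t = ((1 + `|t| `^ alpha)^-1)%:C.

Definition one_sided_stable_law (R : realType) (beta : R)
    (mu : probability R R) :=
  forall t : R, char_fun mu t =
    cexp (- ((`|t| `^ beta)%:C * cexp (- ('i * (pi * beta * Num.sg t / 2)%:C)))).

Definition laplace_pdf (R : realType) (x : R) : R := expR (- `|x|) / 2.

Definition laplace_law (R : realType) (mu : probability R R) :=
  forall A : set R, measurable A ->
    mu A = (\int[lebesgue_measure]_(x in A) (laplace_pdf x)%:E)%E.

(* Mutual independence: each of A, B, C may be the whole line, so the product
   rule for the pairs is included. *)
Definition independent3 d (T : measurableType d) (R : realType)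
    (P : probability T R) (X Y Z : {RV P >-> R}) :=
  forall A B C : set R, measurable A -> measurable B -> measurable C ->
    P (X @^-1` A `&` Y @^-1` B `&` Z @^-1` C) =
    (P (X @^-1` A) * P (Y @^-1` B) * P (Z @^-1` C))%E.

(* The random variables may live on different probability spaces. *)
Definition eq_in_distribution d1 d2 (T1 : measurableType d1)
    (T2 : measurableType d2) (R : realType) (P1 : probability T1 R)
    (P2 : probability T2 R) (X : {RV P1 >-> R}) (Y : {RV P2 >-> R}) :=
  forall A : set R, measurable A -> distribution P1 X A = distribution P2 Y A.

Lemma measurable_sqrtr (R : realType) :
  measurable_fun [set: R] (Num.sqrt : R -> R).
Proof. by apply: continuous_measurable_fun; exact: sqrt_continuous. Qed.

HB.instance Definition _ (R : realType) :=
  isMeasurableFun.Build _ _ R R (Num.sqrt : R -> R) (@measurable_sqrtr R).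

Lemma measurable_invr (R : realType) :
  measurable_fun [set: R] (GRing.inv : R -> R).
Proof.
have -> : (GRing.inv : R -> R) = (fun x => x * (x ^+ 2) `^ (-1)).
  apply/funext => x; rewrite powR_inv1 ?sqr_ge0//.
  have [->|x0] := eqVneq x 0; first by rewrite invr0 mul0r.
  by rewrite expr2 invfM mulrA mulfV// mul1r.
apply: measurable_funM => //.
apply: (measurableT_comp (@measurable_powR R (-1))).
exact: measurable_funX.
Qed.

HB.instance Definition _ (R : realType) :=
  isMeasurableFun.Build _ _ R R (GRing.inv : R -> R) (@measurable_invr R).

Arguments eq_in_distribution {d1 d2 T1 T2 R} P1 P2 X Y.
Arguments independent3 {d T R} P X Y Z.

(* Main.v *)
(* Write b = alpha / 2.  Conditioning on S and S', the characteristic function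
   of the mixture at t is E[1 / (1 + t^2 S / S')] = E[S' / (S' + t^2 S)], which
   equals the integral over u > 0 of E[S' exp(- u S')] E[exp(- u t^2 S)].  With
   E exp(- u S) = exp(- u^b) this is 1 / (1 + t^(2 b)).

   The stable laws are only known through their characteristic function phi, so
   their positivity and their Laplace transform come from a uniqueness theorem
   for bounded harmonic functions.  On the closed half-plane 0 <= a, both
   E exp(i t S - a |S|) and exp(- (a - i t)^b) are bounded and harmonic in
   (a, t) and agree with phi for a = 0.  In the coordinates a = e^s cos t',
   t = e^s sin t' the half-plane becomes a strip, on which they coincide by the
   maximum principle with a quadratic barrier.  At t = 0 this is the Laplace
   transform of |S|; comparing the derivatives there in t and in a yields
   E[S exp(- a |S|)] = E[|S| exp(- a |S|)], whence S >= 0 almost surely.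

   Laws on the line are determined by their characteristic function because the
   latter determines their convolution with Cauchy kernels, whose integrals over
   ]p, q] (differences of arctangents) converge to the measure of ]p, q]. *)
Require Import Defs.
From mathcomp Require Import all_boot all_order all_algebra.
From mathcomp Require Import all_classical all_reals all_analysis.
From mathcomp Require Import measurable_realfun complex ring lra.

Set Implicit Arguments.
Unset Strict Implicit.
Unset Printing Implicit Defensive.

Import Order.TTheory GRing.Theory Num.Theory.
Import numFieldNormedType.Exports.

Local Open Scope classical_set_scope.
Local Open Scope ring_scope.

(** * Bounded functions on finite measures *)

Lemma bounded_integrable d (T : measurableType d) (R : realType)
    (P : {finite_measure set T -> \bar R}) (f : T -> R) (M : R) :
  measurable_fun setT f -> (forall x, `|f x| <= M) ->
  P.-integrable setT (EFin \o f).
Proof.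
move=> mf fM; apply: measurable_bounded_integrable => //.
  exact: fin_num_fun_lty.
exists M; split; first exact: num_real.
by move=> B MB x _ /=; rewrite (le_trans (fM x))// ltW.
Qed.

Lemma bounded_Rintegral_cvg d (T : measurableType d) (R : realType)
    (P : {finite_measure set T -> \bar R}) (f_ : (T -> R)^nat) (f : T -> R)
    (M : R) :
  (forall n, measurable_fun setT (f_ n)) -> (forall n x, `|f_ n x| <= M) ->
  (forall x, f_ ^~ x @ \oo --> f x) ->
  (\int[P]_x f_ n x) @[n --> \oo] --> \int[P]_x f x.
Proof.
move=> mf_ fM ff.
have mf : measurable_fun setT (EFin \o f).
  apply: (@emeasurable_fun_cvg _ _ _ _ (fun n => EFin \o f_ n)) => [n|x _].
    exact/measurable_EFinP.
  by apply: cvg_EFin; [exact: nearW | exact: ff].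
have [||||itf _ h] := @dominated_convergence _ _ _ P setT measurableT
    (fun n => EFin \o f_ n) (EFin \o f) (EFin \o cst M) _ mf _ _ _.
- by move=> n; exact/measurable_EFinP.
- by apply: aeW => x _; apply: cvg_EFin; [exact: nearW | exact: ff].
- exact: finite_measure_integrable_cst.
- by apply: aeW => x n _; rewrite lee_fin.
by apply: fine_cvg; rewrite fineK//; exact: integrable_fin_num.
Qed.

Lemma probability_Rintegral_cst d (T : measurableType d) (R : realType)
    (P : probability T R) (r : R) : \int[P]_x r = r.
Proof. by rewrite Rintegral_cst// [X in fine X]probability_setT mulr1. Qed.

Lemma normr_probability_Rintegral d (T : measurableType d) (R : realType)
    (P : probability T R) (f : T -> R) (M : R) :
  measurable_fun setT f -> (forall x, `|f x| <= M) -> `|\int[P]_x f x| <= M.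
Proof.
move=> mf fM.
have intf : P.-integrable setT (EFin \o f) by exact: bounded_integrable fM.
rewrite (le_trans (le_normr_Rintegral _ _))//.
rewrite -[leRHS](probability_Rintegral_cst P); apply: le_Rintegral => //.
  exact: integrable_norm.
exact: finite_measure_integrable_cst.
Qed.

Lemma normr_cos_le1 (R : realType) (x : R) : `|cos x| <= 1.
Proof. by rewrite ler_norml cos_geN1 cos_le1. Qed.

Lemma normr_sin_le1 (R : realType) (x : R) : `|sin x| <= 1.
Proof. by rewrite ler_norml sin_geN1 sin_le1. Qed.

Lemma measurable_cos (R : realType) : measurable_fun [set: R] (@cos R).
Proof. by apply: continuous_measurable_fun; exact: continuous_cos. Qed.

Lemma measurable_sin (R : realType) : measurable_fun [set: R] (@sin R).
Proof. by apply: continuous_measurable_fun; exact: continuous_sin. Qed.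

(** * A maximum principle on a strip *)

(** A mean value form of the second difference, exact for each step h. Discrete Laplacians of
    explicit functions can thus be estimated through second derivatives at nearby points. *)
Lemma second_difference (R : realType) (f f' f'' : R -> R) (x h : R) : 0 < h ->
  (forall y : R, is_derive y 1 f (f' y)) ->
  (forall y : R, is_derive y 1 f' (f'' y)) ->
  exists2 z, `|z - x| < h & f (x + h) + f (x - h) - f x *+ 2 = h ^+ 2 * f'' z.
Proof.
move=> h0 df df'.
(* [K] is the value that makes [psi] agree at 0 and h. Rolle then gives y with f' (x + y) - f' (x -
   y) = 2 y K, and the mean value theorem for f' turns K into a value of f''. *)
pose K := (f (x + h) + f (x - h) - f x *+ 2) / h ^+ 2.
pose psi s := f (x + s) + f (x - s) - K * s ^+ 2.
have dpsi (s : R) : is_derive s 1 psi (f' (x + s) - f' (x - s) - K * (s *+ 2)).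
  by rewrite /psi; apply: is_derive_eq; rewrite /GRing.scale/=; ring.
have cpsi : {within `[0, h], continuous psi}.
  apply: derivable_within_continuous => y _.
  by have [] := dpsi y.
have psi0 : psi 0 = psi h.
  rewrite /psi /K divfK ?expf_neq0 ?gt_eqF// addr0 subr0 expr0n mulr0; ring.
have [y] := Rolle h0 (fun y _ => @ex_derive _ _ _ _ _ _ _ (dpsi y)) cpsi psi0.
rewrite in_itv/= => /andP[y0 yh] [_].
have [_ ->] := dpsi y => dy.
have xyxy : x - y < x + y by lra.
have cf' : {within `[x - y, x + y], continuous f'}.
  apply: derivable_within_continuous => z _.
  by have [] := df' z.
have [z] := MVT xyxy (fun z _ => df' z) cf'.
rewrite in_itv/= => /andP[z1 z2] e; exists z; first by rewrite ltr_norml; lra.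
have /eqP : (y *+ 2) * (f'' z - K) = 0 by rewrite mulrBr -dy e; ring.
rewrite mulf_eq0 mulrn_eq0/= gt_eqF//= subr_eq0 => /eqP ->.
by rewrite /K mulrC divfK// expf_neq0// gt_eqF.
Qed.

(** Continuity is reduced to sequences because dominated convergence supplies limits along
    sequences. A failure at level e yields points of A tending to p, one for each n, that contradict
    the hypothesis. *)
Lemma within_cvg_seq (R : realType) (f : R * R -> R) (A : set (R * R))
    (p : R * R) :
  (forall s_ t_ : R^nat, (forall n, A (s_ n, t_ n)) ->
     s_ @ \oo --> p.1 -> t_ @ \oo --> p.2 ->
     f (s_ n, t_ n) @[n --> \oo] --> f p) ->
  f @ within A (nbhs p) --> f p.
Proof.
move=> fseq; apply/cvgrPdist_lt => e e0; apply: contrapT => nf.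
have /choice[q_ q_P] n : exists q, [/\ A q, `|p.1 - q.1| < harmonic n,
    `|p.2 - q.2| < harmonic n & e <= `|f p - f q|].
  apply: contrapT => nq; apply: nf; rewrite near_withinE.
  have := @nbhsx_ballx _ _ p (harmonic n) (harmonic_gt0 n).
  apply: filterS => q [q1 q2] Aq; rewrite ltNge; apply/negP => fe.
  by apply: nq; exists q; split.
have h0 := @cvg_harmonic R.
have s1 : (fun n => (q_ n).1) @ \oo --> p.1.
  apply/cvgrPdist_lt => d d0; near=> n.
  have [_ /lt_trans -> //] := q_P n; rewrite -[ltLHS]ger0_norm ?harmonic_ge0//.
  by near: n; apply: cvgr0_norm_lt.
have s2 : (fun n => (q_ n).2) @ \oo --> p.2.
  apply/cvgrPdist_lt => d d0; near=> n.
  have [_ _ /lt_trans -> //] := q_P n;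
    rewrite -[ltLHS]ger0_norm ?harmonic_ge0//.
  by near: n; apply: cvgr0_norm_lt.
have := fseq _ _ _ s1 s2.
move=> /(_ _)/cvgrPdist_lt/(_ _ e0)[|N _ /(_ N (leqnn N))/=].
  by move=> n; rewrite -surjective_pairing; have [] := q_P n.
by rewrite -surjective_pairing ltNge; have [_ _ _ ->] := q_P N.
Unshelve. all: by end_near. Qed.

(* [h ^+ 2] times the five-point discrete Laplacian *)
Definition dlap (R : realType) (D : R -> R -> R) (h s t : R) : R :=
  D (s + h) t + D (s - h) t + D s (t + h) + D s (t - h) - D s t *+ 4.

(** An argument of Phragmen-Lindelof type: subtracting a small multiple of a barrier from D forces
    the maximum into a bounded rectangle, and there the discrete Laplacian has the wrong sign.
    Harmonicity is expressed by discrete Laplacians since these pass under an integral by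
    linearity. *)
Lemma strip_max (R : realType) (D : R -> R -> R) (M : R) :
  (forall s t, `|t| <= pi / 2 -> D s t <= M) ->
  (forall (s_ t_ : R^nat) s t, (forall n, `|t_ n| <= pi / 2) ->
     `|t| <= pi / 2 -> s_ @ \oo --> s -> t_ @ \oo --> t ->
     D (s_ n) (t_ n) @[n --> \oo] --> D s t) ->
  (forall s t, `|t| = pi / 2 -> D s t <= 0) ->
  (forall s t, `|t| < pi / 2 ->
     (harmonic n) ^- 2 * dlap D (harmonic n) s t @[n --> \oo] --> 0) ->
  forall s t, `|t| <= pi / 2 -> D s t <= 0.
Proof.
move=> DM Dc D0 Dlap s0 t0 t0pi; rewrite leNgt; apply/negP => Dst0.
have pi4 : (pi : R) / 2 <= 2.
  exact/ltW/pihalf_lt2.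
(* The barrier is positive on the strip, tends to infinity, and is strictly
   superharmonic. *)
pose v (s t : R) := s ^+ 2 + 10 - 2 * t ^+ 2.
have v_gt s t : `|t| <= pi / 2 -> s ^+ 2 < v s t.
  move=> tpi; have : `|t| ^+ 2 <= 2 ^+ 2.
    by rewrite lerXn2r ?nnegrE// (le_trans tpi).
  by rewrite real_normK ?num_real// /v; lra.
have v_gt0 s t : `|t| <= pi / 2 -> 0 < v s t.
  by move=> /(v_gt s); apply: le_lt_trans; rewrite sqr_ge0.
(* With this [e] the barrier takes away exactly half of D at (s0, t0), so the difference [E] stays
   positive there. *)
pose e := D s0 t0 / 2 / v s0 t0.
have e0 : 0 < e by rewrite !divr_gt0 // v_gt0.
(* The three summands put (s0, t0) inside the rectangle, give 1 <= N, and give M <= e N <= e N^2, so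
   that the barrier outweighs D on the sides |s| = N. *)
pose N := `|s0| + 1 + `|M| / e.
have N1 : 1 <= N by rewrite /N -addrA addrCA lerDl addr_ge0 // divr_ge0// ltW.
have s0N : `|s0| < N.
  by rewrite /N -addrA ltrDl ltr_pwDl// divr_ge0// ltW.
have MN : M <= e * N ^+ 2.
  rewrite (le_trans (ler_norm _))//.
  have -> : `|M| = e * (`|M| / e) by rewrite mulrC divfK ?gt_eqF.
  rewrite ler_pM2l//; apply: (@le_trans _ _ N).
    by rewrite /N lerDr addr_ge0.
  by rewrite expr2 ler_peMl// (le_trans _ N1).
pose E (p : R * R) := D p.1 p.2 - e * v p.1 p.2.
pose K := `[-N, N]%classic `*` `[-(pi/2), pi/2]%classic : set (R * R).
have KE p : K p <-> `|p.1| <= N /\ `|p.2| <= pi / 2.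
  by rewrite /K /= !in_itv/= !ler_norml.
have cK : compact K by apply: compact_setX; exact: segment_compact.
have cE : {within K, continuous E}.
  apply/subspace_continuousP => p /KE[_ p2]; apply: within_cvg_seq.
  move=> s_ t_ Kst s_p t_p; apply: cvgB.
    by apply: Dc => // n; have /KE[] := Kst n.
  apply: cvgMr; apply: cvgB.
    by apply: cvgD; [exact: (continuous_cvg _ (@exprn_continuous _ 2 _)) |
      exact: cvg_cst].
  by apply: cvgMr; exact: (continuous_cvg _ (@exprn_continuous _ 2 _)).
have K0 : K (s0, t0) by apply/KE; split => //=; exact: ltW.
have [[s1 t1]] := compact_EVT_max (ex_intro _ _ K0) cK cE.
move=> /set_mem /KE/= [s1N t1pi] Emax.
have E1 : 0 < D s1 t1 - e * v s1 t1.
  apply: (lt_le_trans _ (Emax _ (mem_set K0))); rewrite /E/= /e.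
  by rewrite divfK ?gt_eqF ?v_gt0//; lra.
(* The maximum is interior: for |t1| = pi / 2 one has D <= 0, and for |s1| = N one has e v > M, both
   against [E1]. *)
have t1lt : `|t1| < pi / 2.
  rewrite lt_neqAle t1pi andbT; apply/eqP => /(D0 s1).
  by have := mulr_gt0 e0 (v_gt0 s1 _ t1pi); lra.
have s1lt : `|s1| < N.
  rewrite lt_neqAle s1N andbT; apply/eqP => s1E.
  have := v_gt s1 _ t1pi;
    rewrite -(ltr_pM2l e0) -[s1 ^+ 2]real_normK ?num_real// s1E.
  by have := DM s1 _ t1pi; lra.
(* At the maximum the discrete Laplacian of [E] is at most 0. The barrier is quadratic, so its own
   discrete Laplacian is exactly (2 - 4) h^2. *)
have lapE h : 0 <= h -> `|s1| + h <= N -> `|t1| + h <= pi / 2 ->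
    dlap D h s1 t1 <= - 2 * e * h ^+ 2.
  move=> h0 s1h t1h.
  have Emax' s t : `|s| <= N -> `|t| <= pi / 2 -> E (s, t) <= E (s1, t1).
    by move=> ? ?; apply: Emax; rewrite inE; apply/KE.
  have := Emax' (s1 + h) t1 _ t1pi.
  have := Emax' (s1 - h) t1 _ t1pi.
  have := Emax' s1 (t1 + h) s1N _.
  have := Emax' s1 (t1 - h) s1N _.
  rewrite !(le_trans (ler_normD _ _)) ?normrN ?(ger0_norm h0)//.
  move=> /(_ isT) a1 /(_ isT) a2 /(_ isT) a3 /(_ isT) a4.
  move: a1 a2 a3 a4; rewrite /E /= /v /dlap; nra.
have H := Dlap s1 t1 t1lt.
suff : 0 <= - 2 * e by lra.
rewrite -[leLHS](cvg_lim _ H)//; apply: limr_le; first exact: cvgP H.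
have hs : \forall n \near \oo, @harmonic R n < N - `|s1|.
  by apply: cvgr_lt (@cvg_harmonic R) _ _; rewrite subr_gt0.
have ht : \forall n \near \oo, @harmonic R n < pi / 2 - `|t1|.
  by apply: cvgr_lt (@cvg_harmonic R) _ _; rewrite subr_gt0.
near=> n; have h0 := @harmonic_gt0 R n.
rewrite mulrC ler_pdivrMr ?exprn_gt0//; apply: lapE; first exact: ltW.
  by rewrite addrC -lerBrDr ltW//; near: n.
by rewrite addrC -lerBrDr ltW//; near: n.
Unshelve. all: by end_near. Qed.

Lemma strip_eq0 (R : realType) (D : R -> R -> R) (M : R) :
  (forall s t, `|t| <= pi / 2 -> `|D s t| <= M) ->
  (forall (s_ t_ : R^nat) s t, (forall n, `|t_ n| <= pi / 2) ->
     `|t| <= pi / 2 -> s_ @ \oo --> s -> t_ @ \oo --> t ->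
     D (s_ n) (t_ n) @[n --> \oo] --> D s t) ->
  (forall s t, `|t| = pi / 2 -> D s t = 0) ->
  (forall s t, `|t| < pi / 2 ->
     (harmonic n) ^- 2 * dlap D (harmonic n) s t @[n --> \oo] --> 0) ->
  forall s t, `|t| <= pi / 2 -> D s t = 0.
Proof.
move=> DM Dc D0 Dlap s0 t0 tpi; apply/eqP; rewrite eq_le -[X in _ && X]oppr_le0.
apply/andP; split.
  apply: (@strip_max _ D M) => // [s t /(DM s)|s t /D0 ->//].
  by apply: le_trans; exact: ler_norm.
apply: (@strip_max _ (fun s t => - D s t) M) => //.
- by move=> s t /(DM s); apply: le_trans; rewrite -normrN; exact: ler_norm.
- by move=> s_ t_ s t t_pi {}tpi ss tt; apply: cvgN; exact: Dc.
- by move=> s t /D0 ->; rewrite oppr0.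
- move=> s t /(Dlap s); rewrite -[X in _ -> _ --> X]oppr0 => /cvgN.
  apply: cvg_trans; apply: near_eq_cvg; apply: nearW => n /=.
  transitivity (- (harmonic n ^- 2 * dlap D (harmonic n) s t)) => //.
  by rewrite -mulrN /dlap; congr (_ * _); ring.
Qed.

(** * The harmonic kernel *)

Section kernel.
Variable R : realType.
Implicit Types c s t x : R.

(* With z = exp (s - i t), [expcos c s t x] and [expsin c s t x] are, for
   [0 <= x], the real and imaginary parts of exp (- z x - i c); for [x < 0] the
   conjugate of z takes the place of z, and |x| that of x. *)
Definition decay s t x := expR s * cos t * `|x|.
Definition phase s t x := expR s * sin t * x.
Definition expcos c s t x := expR (- decay s t x) * cos (phase s t x - c).
Definition expsin c s t x := expR (- decay s t x) * sin (phase s t x - c).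
(** The second derivative of [expcos] in s and, up to sign, also in t. That the two cancel is the
    harmonicity of [expcos], which the coordinates (s, t) preserve because the exponential is
    conformal. *)
Definition expcos_ss c s t x :=
  (decay s t x ^+ 2 - phase s t x ^+ 2 - decay s t x) * expcos c s t x +
  (2 * decay s t x - 1) * phase s t x * expsin c s t x.

Lemma is_derive_expcos_s c s t x : is_derive s 1 (fun s => expcos c s t x)
  (- (decay s t x * expcos c s t x) - phase s t x * expsin c s t x).
Proof.
by rewrite /expcos /expsin /decay /phase; apply: is_derive_eq;
  rewrite /GRing.scale/=; ring.
Qed.

Lemma is_derive_expcos_ss c s t x : is_derive s 1
  (fun s => - (decay s t x * expcos c s t x) - phase s t x * expsin c s t x)
    (expcos_ss c s t x).
Proof.
rewrite /expcos_ss /expcos /expsin /decay /phase; apply: is_derive_eq;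
  rewrite /GRing.scale/=; ring.
Qed.

Lemma is_derive_expcos_t c s t x : is_derive t 1 (fun t => expcos c s t x)
  (expR s * sin t * `|x| * expcos c s t x - expR s * cos t * x *
   expsin c s t x).
Proof.
by rewrite /expcos /expsin /decay /phase; apply: is_derive_eq;
  rewrite /GRing.scale/=; ring.
Qed.

Lemma is_derive_expcos_tt c s t x : is_derive t 1
  (fun t => expR s * sin t * `|x| * expcos c s t x -
            expR s * cos t * x * expsin c s t x) (- expcos_ss c s t x).
Proof.
have xx : `|x| ^+ 2 = x ^+ 2 by rewrite real_normK ?num_real.
rewrite /expcos_ss /expcos /expsin /decay /phase; apply: is_derive_eq;
  rewrite /GRing.scale/=.
ring: xx.
Qed.

(** The mean value form is used once in each variable. The intermediate points differ, so the two
    second derivatives need not cancel exactly, but they do in the limit h -> 0. *)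
Lemma dlap_expcos c h s t x : 0 < h -> exists s' t',
  [/\ `|s' - s| < h, `|t' - t| < h &
   dlap (fun s t => expcos c s t x) h s t = h ^+ 2 * (expcos_ss c s' t x -
     expcos_ss c s t' x)].
Proof.
move=> h0.
have [s' s's es] := second_difference s h0 (fun s => is_derive_expcos_s c s t x)
  (fun s => is_derive_expcos_ss c s t x).
have [t' t't et] := second_difference t h0 (fun t => is_derive_expcos_t c s t x)
  (fun t => is_derive_expcos_tt c s t x).
exists s', t'; split => //; rewrite mulrBr -es -[- (h ^+ 2 * _)]mulrN -et /dlap.
ring.
Qed.

Lemma normr_expcos c s t x : 0 <= cos t -> `|expcos c s t x| <= 1.
Proof.
move=> t0; rewrite normrM -[leRHS]mulr1 ler_pM//.
  rewrite gtr0_norm ?expR_gt0// -[leRHS]expR0 ler_expR oppr_le0.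
  by rewrite /decay !mulr_ge0// expR_ge0.
exact: normr_cos_le1.
Qed.

Lemma normr_phase d s t x : 0 < d -> d <= cos t ->
  `|phase s t x| <= decay s t x / d.
Proof.
move=> d0 dt; rewrite /phase /decay !normrM (gtr0_norm (expR_gt0 _)).
rewrite ler_pdivlMr// mulrAC ler_wpM2r// -mulrA ler_wpM2l ?expR_ge0//.
rewrite (le_trans _ dt)// -[leRHS]mul1r ler_wpM2r ?(ltW d0)//.
exact: normr_sin_le1.
Qed.

Lemma expRN_mul_le (r : R) : 0 <= r -> r * expR (- r) <= 1.
Proof.
move=> r0; rewrite expRN ler_pdivrMr ?expR_gt0// mul1r.
by rewrite (le_trans _ (expR_ge1Dx r)) // lerDr.
Qed.

Lemma expRN_sqr_le (r : R) : 0 <= r -> r ^+ 2 * expR (- r) <= 4.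
Proof.
move=> r0; have -> : r ^+ 2 * expR (- r) = 4 * (r / 2 * expR (- (r / 2))) ^+ 2.
  have -> : expR (- r) = expR (- (r / 2)) ^+ 2.
    by rewrite -expRM_natl; congr expR; lra.
  by field.
rewrite -[leRHS]mulr1 ler_pM2l// expr_le1//; first by rewrite expRN_mul_le//
  divr_ge0.
by rewrite mulr_ge0 ?divr_ge0 ?expR_ge0.
Qed.


(** The phase is at most decay / d, so each monomial in decay and phase is absorbed by the
    exponential, uniformly in x. The monomials add up to at most 18 / d^2, rounded up to 20. *)
Lemma normr_expcos_ss d c s t x : 0 < d -> d <= 1 -> d <= cos t ->
  `|expcos_ss c s t x| <= 20 / d ^+ 2.
Proof.
move=> d0 d1 dt; rewrite /expcos_ss /expcos /expsin.
have r0 : 0 <= decay s t x.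
  by rewrite /decay !mulr_ge0 ?expR_ge0// (le_trans _ dt)// ltW.
have iq := normr_phase s x d0 dt.
set r := decay s t x in r0 iq *; set q := phase s t x in iq *.
have h1 := expRN_mul_le r0.
have h2 := expRN_sqr_le r0.
have e0 := expR_gt0 (- r).
have cc : `|cos (q - c)| <= 1 by exact: normr_cos_le1.
have ss : `|sin (q - c)| <= 1 by exact: normr_sin_le1.
have q2 : `|q| ^+ 2 <= r ^+ 2 / d ^+ 2.
  by rewrite -expr_div_n lerXn2r ?nnegrE ?divr_ge0// ltW.
apply: (@le_trans _ _ (expR (- r) * ((r ^+ 2 + `|q| ^+ 2 + r) + (2 * r + 1) *
  `|q|))).
  rewrite mulrCA [X in _ + X]mulrCA -mulrDr normrM gtr0_norm//.
  rewrite ler_wpM2l ?(ltW e0)// (le_trans (ler_normD _ _))// lerD//.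
    rewrite normrM -[leRHS]mulr1 ler_pM//.
    rewrite (le_trans (ler_normB _ _))// (ger0_norm r0) lerD2r.
    by rewrite (le_trans (ler_normB _ _))// !normrX (ger0_norm r0).
  rewrite normrM -[leRHS]mulr1 ler_pM// normrM ler_wpM2r//.
  by rewrite (le_trans (ler_normB _ _))// ger0_norm ?normr1// mulr_ge0.
have dV : 1 <= d^-1 by rewrite invf_ge1.
have dV2 : d^-1 <= d^-1 ^+ 2 by rewrite expr2 ler_peMl// (le_trans _ dV).
have dd : d ^- 2 = d^-1 ^+ 2 by rewrite exprVn.
rewrite dd; move: q2; rewrite dd; set D := d^-1 in dV dV2 *; move=> q2.
move: iq; rewrite -/D => iq.
have k1 : expR (- r) * `|q| ^+ 2 <= 4 * D ^+ 2.
  rewrite (le_trans (_ : _ <= expR (- r) * (r ^+ 2 * D ^+ 2)))//.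
    by rewrite ler_wpM2l// ltW.
  by rewrite mulrA [expR _ * _]mulrC ler_wpM2r// sqr_ge0.
have k2 : expR (- r) * (r * `|q|) <= 4 * D.
  rewrite (le_trans (_ : _ <= expR (- r) * (r * (r * D))))//.
    by rewrite ler_wpM2l ?(ltW e0)// ler_wpM2l.
  by rewrite mulrA mulrA -(mulrA _ r r) [expR _ * _]mulrC ler_wpM2r//
    (le_trans _ dV).
have k3 : expR (- r) * `|q| <= D.
  rewrite (le_trans (_ : _ <= expR (- r) * (r * D)))//.
    by rewrite ler_wpM2l// ltW.
  by rewrite mulrA [expR _ * _]mulrC -[leRHS]mul1r ler_wpM2r// (le_trans _ dV).
nra.
Qed.
End kernel.

Lemma near_bounded_Rintegral_cvg d (T : measurableType d) (R : realType)
    (P : {finite_measure set T -> \bar R}) (f_ : (T -> R)^nat) (f : T -> R)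
    (M : R) :
  (forall n, measurable_fun setT (f_ n)) ->
  (\forall n \near \oo, forall x, `|f_ n x| <= M) ->
  (forall x, f_ ^~ x @ \oo --> f x) ->
  (\int[P]_x f_ n x) @[n --> \oo] --> \int[P]_x f x.
Proof.
move=> mf [N _ fM] ff; rewrite -(cvg_shiftn N).
apply: (@bounded_Rintegral_cvg _ _ _ _ (fun n => f_ (n + N)%N) _ M) => //
  [n x|x].
  by apply: fM; rewrite /= leq_addl.
by rewrite (cvg_shiftn N (f_ ^~ x)).
Qed.

Lemma cvg_dist_lt (R : realType) (h_ u_ : R^nat) (l : R) :
  (forall n, `|u_ n - l| < h_ n) -> h_ @ \oo --> 0 -> u_ @ \oo --> l.
Proof.
move=> uh h0; apply/cvgrPdist_lt => e e0; near=> n.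
rewrite distrC (lt_trans (uh n))//.
by near: n; apply: cvgr_lt h0 _ e0.
Unshelve. all: by end_near. Qed.

Section kernel_cvg.
Variable R : realType.
Implicit Types c s t x : R.

Lemma continuous_expcos_ss_s c t x : continuous (fun s => expcos_ss c s t x).
Proof.
move=> s; apply: differentiable_continuous; apply/derivable1_diffP.
rewrite /expcos_ss /expcos /expsin /decay /phase; exact: ex_derive.
Qed.

Lemma continuous_expcos_ss_t c s x : continuous (fun t => expcos_ss c s t x).
Proof.
move=> t; apply: differentiable_continuous; apply/derivable1_diffP.
rewrite /expcos_ss /expcos /expsin /decay /phase; exact: ex_derive.
Qed.

Lemma cvg_dlap_expcos c s t x (h_ : R^nat) : (forall n, 0 < h_ n) ->
  h_ @ \oo --> 0 ->
  (h_ n) ^- 2 * dlap (fun s t => expcos c s t x) (h_ n) s t @[n --> \oo] --> 0.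
Proof.
move=> h0 hcv.
have /choice[s_ /choice[t_ H]] := fun n => dlap_expcos c s t x (h0 n).
have -> : (fun n => (h_ n) ^- 2 * dlap (fun s t => expcos c s t x) (h_ n) s t) =
    (fun n => expcos_ss c (s_ n) t x - expcos_ss c s (t_ n) x).
  apply/funext => n; have [_ _ ->] := H n.
  by rewrite mulrA mulVf ?mul1r// expf_neq0// gt_eqF.
rewrite -[X in _ --> X](subrr (expcos_ss c s t x)); apply: cvgB.
  apply: (continuous_cvg _ (@continuous_expcos_ss_s c t x s)).
  by apply: cvg_dist_lt hcv => n; have [] := H n.
apply: (continuous_cvg _ (@continuous_expcos_ss_t c s x t)).
by apply: cvg_dist_lt hcv => n; have [] := H n.
Qed.

(** The bound is uniform in x: it is the domination with which the limit h -> 0 passes under the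
    integral over x. *)
Lemma near_normr_dlap_expcos c s t : `|t| < pi / 2 -> exists M,
  \forall h \near (0 : R)^'+, forall x,
    `|h ^- 2 * dlap (fun s t => expcos c s t x) h s t| <= M.
Proof.
rewrite ltr_norml => tpi; have c0 := cos_gt0_pihalf tpi.
(* Half of cos t remains a lower bound of the cosine around t, and for small h the intermediate
   point t' lies there. *)
pose d := cos t / 2.
have d0 : 0 < d by rewrite divr_gt0.
have d1 : d <= 1 by have := cos_le1 t; rewrite /d; lra.
have ct : \forall u \near t, d <= cos u.
  have cct : cos u @[u --> t] --> cos t := @continuous_cos R t.
  apply: (cvgr_ge _ cct).
  by rewrite /d; lra.
have [e /= e0 He] := ct.
exists (20 / d ^+ 2 + 20 / d ^+ 2); near=> h => x.
have h0 : 0 < h by [].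
have [s' [t' [s's t't ->]]] := dlap_expcos c s t x h0.
rewrite mulrA mulVf ?mul1r ?expf_neq0 ?gt_eqF//.
rewrite (le_trans (ler_normB _ _))// lerD// normr_expcos_ss//.
  by rewrite /d; lra.
apply: He; rewrite /ball/= distrC (lt_trans t't)//.
Unshelve. all: by end_near. Qed.

Lemma measurable_expcos c s t : measurable_fun [set: R] (expcos c s t).
Proof.
apply: measurable_funM.
  apply: measurableT_comp => //; apply: measurableT_comp => //.
  by apply: measurable_funM.
apply: (measurableT_comp (@measurable_cos R)).
by apply: measurable_funB => //; apply: measurable_funM.
Qed.

End kernel_cvg.

(** * Laplace transform of the one-sided stable laws *)

Section stable.
Variables (R : realType) (b : R) (mu : probability R R).
Hypothesis mu_stable : one_sided_stable_law b mu.

Let integrable_cos (q : R) : mu.-integrable setT (EFin \o (fun x =>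
  cos (q * x))).
Proof.
apply: (@bounded_integrable _ _ _ _ _ 1).
  apply: (measurableT_comp (@measurable_cos R)).
  by apply: measurable_funM.
by move=> x; exact: normr_cos_le1.
Qed.

Let integrable_sin (q : R) : mu.-integrable setT (EFin \o (fun x =>
  sin (q * x))).
Proof.
apply: (@bounded_integrable _ _ _ _ _ 1).
  apply: (measurableT_comp (@measurable_sin R)).
  by apply: measurable_funM.
by move=> x; exact: normr_sin_le1.
Qed.

Lemma stable_cos_sin q :
  let th := pi * b * Num.sg q / 2 in
  \int[mu]_x cos (q * x) =
    expR (- (`|q| `^ b * cos th)) * cos (`|q| `^ b * sin th) /\
  \int[mu]_x sin (q * x) =
    expR (- (`|q| `^ b * cos th)) * sin (`|q| `^ b * sin th).
Proof.
move=> th; have := mu_stable q; rewrite /char_fun /cexp /= -/th.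
rewrite !(mul0r, mul1r, mulr0, oppr0, subr0, addr0, add0r, expR0, cosN, sinN).
by case=> -> ->; rewrite !mulrN cosN sinN mulrN opprK.
Qed.

(** On the boundary of the strip the decay vanishes and the kernel is cos (q x - c) with q = exp s
    or q = - exp s, so the characteristic function applies. Its exponent is z^b with z = exp (s - i
    t), and in logarithmic coordinates this power is multiplication by b. *)
Lemma stable_expcos_boundary c s t : `|t| = pi / 2 ->
  \int[mu]_x expcos c s t x = expcos c (b * s) (b * t) 1.
Proof.
move=> tpi.
have [ct st] : cos t = 0 /\ t = pi / 2 * sin t.
  have [t0|t0] := leP 0 t.
    by rewrite -(ger0_norm t0) tpi cos_pihalf sin_pihalf mulr1.
  have -> : t = - (pi / 2) by rewrite -tpi ltr0_norm// opprK.
  by rewrite cosN sinN cos_pihalf sin_pihalf mulrN1.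
have nst : `|sin t| = 1.
  have := congr1 Num.norm st; rewrite normrM tpi gtr0_norm ?divr_gt0 ?pi_gt0//.
  move=> /eqP; rewrite -[X in X == _]mulr1 => /eqP/mulfI <-//.
  by rewrite gt_eqF// divr_gt0 ?pi_gt0.
pose q := expR s * sin t.
have qn : `|q| = expR s by rewrite normrM nst mulr1 gtr0_norm ?expR_gt0.
have qsg : Num.sg q = sin t.
  by rewrite sgrM gtr0_sg ?expR_gt0// mul1r -[RHS]mulr_sg_norm nst mulr1.
have [Ec Es] := stable_cos_sin q.
rewrite qn qsg in Ec Es.
have th : pi * b * sin t / 2 = b * t by rewrite [in RHS]st; field.
rewrite th in Ec Es.
transitivity (\int[mu]_x (cos c * cos (q * x) + sin c * sin (q * x))).
  apply: eq_Rintegral => x _;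
    rewrite /expcos /decay /phase ct mulr0 mul0r oppr0 expR0 mul1r.
  by rewrite cosB -/q; ring.
rewrite RintegralD//; last 2 first.
- exact: (integrableZl measurableT (cos c) (integrable_cos q)).
- exact: (integrableZl measurableT (sin c) (integrable_sin q)).
rewrite !RintegralZl//
  Ec Es /expcos /decay /phase normr1 !mulr1 -expRM [s * b]mulrC.
by rewrite cosB; ring.
Qed.

Lemma integrable_expcos c s t : `|t| <= pi / 2 ->
  mu.-integrable setT (EFin \o expcos c s t).
Proof.
rewrite ler_norml => /cos_ge0_pihalf t0.
apply: (@bounded_integrable _ _ _ _ _ 1); first exact: measurable_expcos.
by move=> x; exact: normr_expcos.
Qed.

Lemma normr_Rintegral_expcos c s t : `|t| <= pi / 2 ->
  `|\int[mu]_x expcos c s t x| <= 1.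
Proof.
rewrite ler_norml => /cos_ge0_pihalf t0.
apply: normr_probability_Rintegral; first exact: measurable_expcos.
by move=> x; exact: normr_expcos.
Qed.

Lemma measurable_dlap_expcos c h s t :
  measurable_fun [set: R] (fun x => dlap (fun s t => expcos c s t x) h s t).
Proof.
rewrite /dlap; under eq_fun do rewrite -mulr_natl.
apply: measurable_funB; last by apply: measurable_funM => //;
  exact: measurable_expcos.
by do 3?[apply: measurable_funD]; exact: measurable_expcos.
Qed.

Lemma integrable_dlap_expcos c h s t : 0 <= h -> `|t| + h <= pi / 2 ->
  mu.-integrable setT (EFin \o (fun x => dlap (fun s t =>
    expcos c s t x) h s t)).
Proof.
(* Four neighbours and four times the centre, each value of modulus at most 1. *)
move=> h0 th; apply: (@bounded_integrable _ _ _ _ _ 8).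
  exact: measurable_dlap_expcos.
have ck1 u v x : `|v| <= pi / 2 -> `|expcos c u v x| <= 1.
  by rewrite ler_norml => /cos_ge0_pihalf; exact: normr_expcos.
move=> x; have t0 : `|t| <= pi / 2 by rewrite (le_trans _ th)// lerDl.
have := ck1 (s + h) t x t0; have := ck1 (s - h) t x t0; have := ck1 s t x t0.
have t1 : `|t + h| <= pi / 2 by rewrite (le_trans (ler_normD _ _))//
  (ger0_norm h0).
have t2 : `|t - h| <= pi / 2 by rewrite (le_trans (ler_normB _ _))//
  (ger0_norm h0).
have := ck1 s (t + h) x t1; have := ck1 s (t - h) x t2.
rewrite /dlap !ler_norml; lra.
Qed.

Lemma dlap_Rintegral_expcos c h s t : 0 <= h -> `|t| + h <= pi / 2 ->
  dlap (fun s t => \int[mu]_x expcos c s t x) h s t =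
  \int[mu]_x dlap (fun s t => expcos c s t x) h s t.
Proof.
move=> h0 th.
have t0 : `|t| <= pi / 2 by rewrite (le_trans _ th)// lerDl.
have t1 : `|t + h| <= pi / 2 by rewrite (le_trans (ler_normD _ _))//
  (ger0_norm h0).
have t2 : `|t - h| <= pi / 2 by rewrite (le_trans (ler_normB _ _))//
  (ger0_norm h0).
rewrite /dlap -[\int[mu]_x expcos c s t x *+ 4]mulr_natl -RintegralZl//;
  last exact: integrable_expcos.
under [in RHS]eq_Rintegral do rewrite -[_ *+ 4]mulr_natl.
rewrite RintegralB//; last 2 first.
- by do 3?[apply: (@integrableD _ _ _ _ _ _ (EFin \o _) (EFin \o _)) => //];
    exact: integrable_expcos.
- exact: (integrableZl measurableT 4 (integrable_expcos c s t0)).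
rewrite RintegralD//; last 2 first.
- by do 2?[apply: (@integrableD _ _ _ _ _ _ (EFin \o _) (EFin \o _)) => //];
    exact: integrable_expcos.
- exact: integrable_expcos.
rewrite RintegralD//; last 2 first.
- by do 1?[apply: (@integrableD _ _ _ _ _ _ (EFin \o _) (EFin \o _)) => //];
    exact: integrable_expcos.
- exact: integrable_expcos.
by rewrite RintegralD//; exact: integrable_expcos.
Qed.

End stable.

Lemma cvg_expcos (R : realType) (c x : R) (s_ t_ : R^nat) (s t : R) :
  s_ @ \oo --> s -> t_ @ \oo --> t ->
  expcos c (s_ n) (t_ n) x @[n --> \oo] --> expcos c s t x.
Proof.
move=> ss tt; have es := continuous_cvg _ (@continuous_expR R s) ss.
have ct := continuous_cvg _ (@continuous_cos R t) tt.
have st := continuous_cvg _ (@continuous_sin R t) tt.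
apply: cvgM.
  apply: (continuous_cvg _ (@continuous_expR R _)).
  apply: cvgN; apply: cvgM; last exact: cvg_cst.
  by apply: cvgM; [exact: es | exact: ct].
apply: (continuous_cvg _ (@continuous_cos R _)).
apply: cvgB; last exact: cvg_cst.
apply: cvgM; last exact: cvg_cst.
by apply: cvgM; [exact: es | exact: st].
Qed.

(** Strip uniqueness for the difference of the two sides. Each side is bounded by 1; on the right
    this uses b <= 1, which keeps b t in the strip. *)
Lemma stable_expcos (R : realType) (b : R) (mu : probability R R) (c s t : R) :
  0 < b -> b <= 1 -> one_sided_stable_law b mu -> `|t| <= pi / 2 ->
  \int[mu]_x expcos c s t x = expcos c (b * s) (b * t) 1.
Proof.
move=> b0 b1 mu_stable tpi; apply/eqP; rewrite -subr_eq0; apply/eqP.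
pose D s t := \int[mu]_x expcos c s t x - expcos c (b * s) (b * t) 1.
apply: (@strip_eq0 _ D 2) s t tpi.
- move=> s t tpi; rewrite (le_trans (ler_normB _ _))// -[2]/(1 + 1) lerD//.
    exact: normr_Rintegral_expcos.
  apply: normr_expcos; apply: cos_ge0_pihalf;
    rewrite -ler_norml normrM gtr0_norm//.
  by rewrite (le_trans _ tpi)// ler_piMl.
- move=> s_ t_ s t t_pi tpi ss tt; apply: cvgB; last first.
    by apply: cvg_expcos; exact: cvgMr.
  apply: (@bounded_Rintegral_cvg _ _ _ _ (fun n => expcos c (s_ n) (t_ n)) _ 1).
  + by move=> n; exact: measurable_expcos.
  + move=> n x; apply: normr_expcos; apply: cos_ge0_pihalf; rewrite -ler_norml.
    exact: t_pi.
  + by move=> x; exact: cvg_expcos.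
- by move=> s t tpi; rewrite /D (stable_expcos_boundary mu_stable) ?subrr.
- move=> s t tpi.
  have h0 : @harmonic R @ \oo --> 0 := cvg_harmonic.
  pose I n := \int[mu]_x (harmonic n ^- 2 * dlap (fun s t =>
    expcos c s t x) (harmonic n) s t).
  (* In the coordinates (b s, b t) a step h becomes b h, hence the factor b^2 in front of [J] when
     the discrete Laplacian of D is written as I n - b^2 J n. *)
  pose J n := (b * harmonic n) ^- 2 *
    dlap (fun s t => expcos c s t 1) (b * harmonic n) (b * s) (b * t).
  have hpi : \forall n \near \oo, @harmonic R n < pi / 2 - `|t|.
    by apply: cvgr_lt h0 _ _; rewrite subr_gt0.
  have [M HM] := near_normr_dlap_expcos c s tpi.
  have -> : (0 : R) = \int[mu]_x 0 - b ^+ 2 * 0.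
    by rewrite probability_Rintegral_cst mulr0 subr0.
  apply: (@cvg_trans _ ((I n - b ^+ 2 * J n) @[n --> \oo])); last first.
    apply: cvgB; last first.
      apply: cvgMr; apply: cvg_dlap_expcos; last first.
        by rewrite -(mulr0 b); exact: cvgMr.
      by move=> n; rewrite mulr_gt0// harmonic_gt0.
    apply: (@near_bounded_Rintegral_cvg _ _ _ _ (fun n x =>
      harmonic n ^- 2 * dlap (fun s t => expcos c s t x) (harmonic n) s t) _ M).
    + by move=> n; apply: measurable_funM => //; exact: measurable_dlap_expcos.
    + have [e /= e0 He] := HM; near=> n; apply: He.
        rewrite /ball/= sub0r normrN ger0_norm ?harmonic_ge0//.
        by near: n; apply: cvgr_lt h0 _ e0.
      exact: harmonic_gt0.
    + by move=> x; apply: cvg_dlap_expcos h0 => n; exact: harmonic_gt0.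
  apply: near_eq_cvg; near=> n; have hn0 := @harmonic_gt0 R n.
  have hn : `|t| + harmonic n <= pi / 2.
    by rewrite addrC -lerBrDr ltW//; near: n.
  rewrite /I /J RintegralZl//; last first.
    by apply: integrable_dlap_expcos; rewrite ?harmonic_ge0.
  rewrite -dlap_Rintegral_expcos// ?harmonic_ge0//.
  have -> : b ^+ 2 * ((b * harmonic n) ^- 2 *
      dlap (fun s t => expcos c s t 1) (b * harmonic n) (b * s) (b * t)) =
    harmonic n ^- 2 * dlap (fun s t =>
      expcos c s t 1) (b * harmonic n) (b * s) (b * t).
    by field; rewrite !gt_eqF.
  by rewrite -mulrBr; congr (_ * _); rewrite /dlap /D !(mulrDr b) mulrN; ring.
Unshelve. all: by end_near. Qed.

(** * Differentiation under the integral, and positivity of the stable laws *)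

Lemma Rintegral_is_derive (R : realType) d (T : measurableType d)
    (P : probability T R) (f df : R -> T -> R) (K : R -> R) (a r dK M : R) :
  0 < r ->
  (forall t, `|t - a| < r -> measurable_fun setT (f t)) ->
  (forall t x, `|t - a| < r -> `|f t x| <= M) ->
  (forall t x, `|t - a| < r -> is_derive t 1 (f ^~ x) (df t x)) ->
  (forall t x, `|t - a| < r -> `|df t x| <= M) ->
  (forall t, `|t - a| < r -> \int[P]_x f t x = K t) ->
  is_derive a 1 K dK ->
  \int[P]_x df a x = dK.
Proof.
move=> r0 mf fM fdf dfM fK KdK.
have I_lt t : `](a - r), (a + r)[%classic t -> `|t - a| < r.
  by rewrite /= in_itv/= ltr_norml; lra.
have Ia : `](a - r), (a + r)[%classic a by rewrite /= in_itv/=; lra.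
have M0 : 0 <= M.
  (* A set of total mass 1 has a point, and a bound on a norm at that point makes M nonnegative. *)
  have [x _] : exists x : T, True.
    have := probability_setT P; have [->|/set0P[x _]] := eqVneq [set: T] set0.
      by rewrite measure0 => /eqP; rewrite eq_sym onee_eq0.
    by exists x.
  by apply: le_trans (fM a x _); rewrite ?subrr ?normr0.
have e t x : `|t - a| < r -> partial1of2 f t x = df t x.
  by move=> ta; rewrite partial1of2E; have [_ ->] := fdf t x ta.
have H := @cvg_differentiation_under_integral R _ T P f setT measurableT a (a -
  r) (a + r) Ia.
have {}H : h^-1 *: (\int[P]_y f (h + a) y - \int[P]_y f a y) @[h --> 0^'] -->
    \int[P]_x df a x.
  have <- : \int[P]_y partial1of2 f a y = \int[P]_x df a x.
    by apply: eq_Rintegral => x _; rewrite e// subrr normr0.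
  apply: (H _ _ (cst M)) => //.
  - move=> t /I_lt It; apply: (@bounded_integrable _ _ _ _ _ M);
      first exact: mf.
    by move=> x; exact: fM.
  - by move=> t x /I_lt It _; have [] := fdf t x It.
  - exact: finite_measure_integrable_cst.
  - by move=> t x /I_lt It _; rewrite e// dfM.
(* Within distance r of a the integral equals [K], so the difference quotients of both at a coincide
   for small h and have the same limit. *)
have [dK1 <-] := KdK.
apply: (cvg_unique _ H) => //.
apply: cvg_trans dK1; apply: near_eq_cvg.
near=> h; have hr : `|h| < r by near: h; exact: dnbhs0_lt.
by rewrite /= fK ?fK ?subrr ?normr0 ?addrK// /GRing.scale/= mulr1.
Unshelve. all: by end_near. Qed.

Section kernel_derive_bound.
Variable R : realType.
Implicit Types c s t x : R.

Lemma normr_expcos_derive_s c s x :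
  `|- (decay s 0 x * expcos c s 0 x) - phase s 0 x * expsin c s 0 x| <= 1.
Proof.
have -> : phase s 0 x = 0 by rewrite /phase sin0 mulr0 mul0r.
have r0 : 0 <= decay s 0 x by rewrite /decay cos0 mulr1 mulr_ge0 ?expR_ge0.
rewrite mul0r subr0 normrN /expcos mulrA normrM -[leRHS]mulr1 ler_pM//.
  by rewrite ger0_norm ?expRN_mul_le// mulr_ge0 ?expR_ge0.
exact: normr_cos_le1.
Qed.

Lemma normr_expcos_derive_t d c s t x : 0 < d -> d <= cos t ->
  `|expR s * sin t * `|x| * expcos c s t x - expR s * cos t * x * expsin c s t
    x| <=
  d^-1 + 1.
Proof.
move=> d0 dt.
have r0 : 0 <= decay s t x.
  by rewrite /decay !mulr_ge0 ?expR_ge0// (le_trans _ dt)// ltW.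
have iq := normr_phase s x d0 dt.
have h1 := expRN_mul_le r0.
rewrite (le_trans (ler_normB _ _))// lerD//.
  rewrite /expcos mulrA normrM -[leRHS]mulr1 ler_pM//; last first.
    exact: normr_cos_le1.
  rewrite normrM normrM normr_id -normrM -/(phase s t x) (gtr0_norm (expR_gt0
    _)).
  rewrite (le_trans (ler_wpM2r (expR_ge0 _) iq))// mulrAC -[leRHS]mul1r.
  by rewrite ler_wpM2r// invr_ge0 ltW.
rewrite /expsin mulrA normrM -[leRHS]mulr1 ler_pM//; last first.
  exact: normr_sin_le1.
rewrite !normrM (gtr0_norm (expR_gt0 _)) [`|cos t|]ger0_norm; last first.
  by rewrite (le_trans _ dt)// ltW.
by rewrite (gtr0_norm (expR_gt0 _)) -/(decay s t x).
Qed.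
End kernel_derive_bound.

Lemma stable_laplace (R : realType) (b : R) (mu : probability R R) (a : R) :
  0 < b -> b <= 1 -> one_sided_stable_law b mu -> 0 < a ->
  \int[mu]_x expR (- (a * `|x|)) = expR (- (a `^ b)).
Proof.
move=> b0 b1 mus a0.
have pi0 : `|0 : R| <= pi / 2 by rewrite normr0 divr_ge0// pi_ge0.
have := stable_expcos 0 (ln a) b0 b1 mus pi0.
rewrite /expcos /decay /phase mulr0 !cos0 !sin0 !(mulr0, mul0r, subr0) cos0
  normr1 !mulr1.
rewrite /powR gt_eqF// => <-; apply: eq_Rintegral => x _.
by rewrite lnK ?posrE// mul0r subr0 cos0 !mulr1.
Qed.

Lemma measurable_expRNM_norm (R : realType) (a : R) :
  measurable_fun [set: R] (fun x : R => expR (- (a * `|x|))).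
Proof.
apply: measurableT_comp => //; apply: measurableT_comp => //.
exact: measurable_funM.
Qed.

Lemma normr_mul_expRN_norm (R : realType) (a x : R) : 0 < a ->
  `|x * expR (- (a * `|x|))| <= a^-1.
Proof.
move=> a0; rewrite normrM (gtr0_norm (expR_gt0 _)) -[leRHS]mulr1 ler_pdivlMl//
  mulrA.
by apply: expRN_mul_le; rewrite mulr_ge0// ltW.
Qed.

(** The identity of [stable_expcos] is differentiated in s at s = ln a, t = 0. The variable s = ln a
    brings out a factor a, cancelled at the end. *)
Lemma stable_laplace_derive (R : realType) (b : R) (mu :
  probability R R) (a : R) :
  0 < b -> b <= 1 -> one_sided_stable_law b mu -> 0 < a ->
  \int[mu]_x (`|x| * expR (- (a * `|x|))) = b * a `^ (b - 1) * expR (- (a `^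
    b)).
Proof.
move=> b0 b1 mus a0.
have pi0 : `|0 : R| <= pi / 2 by rewrite normr0 divr_ge0// pi_ge0.
have c0 : 0 <= cos 0 :> R by rewrite cos0.
pose k s x : R := - (decay s 0 x * expcos 0 s 0 x) - phase s 0 x * expsin 0 s 0
  x.
have H := @Rintegral_is_derive _ _ _ mu (fun s => expcos 0 s 0) k
  (fun s => expcos 0 (b * s) (b * 0) 1) (ln a) 1 (k (b * ln a) 1 * b) 1 ltr01.
have kE s x : k s x = - (expR s * (`|x| * expR (- (expR s * `|x|)))).
  rewrite /k /expcos /decay /phase cos0 sin0 !(mulr0, mul0r, subr0) cos0 !mulr1.
  by rewrite mulrA.
have mf : measurable_fun [set: R] (fun x : R => `|x| * expR (- (a * `|x|))).
  by apply: measurable_funM => //; exact: measurable_expRNM_norm.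
have fM x : `| `|x| * expR (- (a * `|x|))| <= a^-1.
  by rewrite -[X in expR (- (a * X))]normr_id normr_mul_expRN_norm.
have aE : \int[mu]_x k (ln a) x = - (a * \int[mu]_x (`|x| * expR (- (a *
  `|x|)))).
  rewrite -mulNr -RintegralZl//;
    last exact: (@bounded_integrable _ _ _ _ _ a^-1).
  by apply: eq_Rintegral => x _; rewrite kE lnK ?posrE// mulNr.
have EE : expR (b * ln a) = a `^ b by rewrite /powR gt_eqF.
have -> : a `^ (b - 1) = a `^ b / a.
  by rewrite -EE /powR gt_eqF// mulrBl mul1r expRD expRN lnK.
apply: (mulfI (lt0r_neq0 a0)); apply: oppr_inj; rewrite -aE.
transitivity (k (b * ln a) 1 * b); last first.
  by rewrite kE normr1 !mulr1 mul1r EE; field; rewrite gt_eqF.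
apply: H.
- by move=> s _; exact: measurable_expcos.
- by move=> s x _; apply: normr_expcos.
- by move=> s x _; exact: is_derive_expcos_s.
- by move=> s x _; exact: normr_expcos_derive_s.
- by move=> s _; exact: stable_expcos.
- have d1 := is_derive_expcos_s 0 (b * ln a) 0 1; rewrite mulr0.
  have := @is_derive1_comp _ (fun s => expcos 0 s 0 1) (fun s =>
    b * s) (ln a) _ b d1.
  by apply; apply: is_derive_eq; rewrite /GRing.scale/=; ring.
Qed.

(** The companion in the direction t. There the phase, which carries x, is differentiated instead of
    the decay, which carries |x|; the value on the right is the same. *)
Lemma stable_laplace_derive_signed (R : realType) (b : R) (mu :
  probability R R) (a : R) :
  0 < b -> b <= 1 -> one_sided_stable_law b mu -> 0 < a ->
  \int[mu]_x (x * expR (- (a * `|x|))) = b * a `^ (b - 1) * expR (- (a `^ b)).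
Proof.
move=> b0 b1 mus a0.
(* This shift turns the cosine of the phase into its sine, whose derivative at t = 0 does not
   vanish. *)
pose c : R := pi / 2.
have ct : \forall u \near (0 : R), 2^-1 <= cos u.
  have cct : cos u @[u --> (0 : R)] --> cos 0 := @continuous_cos R 0.
  by apply: (cvgr_ge _ cct); rewrite cos0; lra.
have [e /= e0 He] := ct.
(* The bound [e] keeps the cosine above 1/2, and 1 <= pi / 2 keeps t in the strip. *)
pose r := Num.min e 1.
have r0 : 0 < r by rewrite lt_min e0 ltr01.
have cr t : `|t - 0| < r -> 2^-1 <= cos t.
  move=> tr; apply: He; rewrite /ball/= distrC (lt_le_trans tr)//.
  by rewrite ge_min lexx.
have cr0 t : `|t - 0| < r -> 0 <= cos t.
  by move=> /cr; apply: le_trans; rewrite invr_ge0.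
have rpi t : `|t - 0| < r -> `|t| <= pi / 2.
  rewrite subr0 => tr; rewrite ltW// (lt_le_trans tr)//.
  by rewrite (le_trans _ (@pihalf_ge1 R))// ge_min lexx orbT.
pose k s t x : R := expR s * sin t * `|x| * expcos c s t x - expR s * cos t * x
  * expsin c s t x.
have H := @Rintegral_is_derive _ _ _ mu (fun t => expcos c (ln a) t) (k (ln a))
  (fun t => expcos c (b * ln a) (b * t) 1) 0 r (k (b * ln a) 0 1 * b) (2^-1^-1
    + 1) r0.
have kE s x : k s 0 x = expR s * (x * expR (- (expR s * `|x|))).
  rewrite /k /expcos /expsin /decay /phase cos0 sin0 !(mulr0, mul0r, sub0r,
    subr0).
  by rewrite sinN sin_pihalf !mulr1 mulrN1 mulrN opprK mulrA.
have mf : measurable_fun [set: R] (fun x : R => x * expR (- (a * `|x|))).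
  by apply: measurable_funM => //; exact: measurable_expRNM_norm.
have fM x : `|x * expR (- (a * `|x|))| <= a^-1 by exact: normr_mul_expRN_norm.
have aE : \int[mu]_x k (ln a) 0 x = a * \int[mu]_x (x * expR (- (a * `|x|))).
  rewrite -RintegralZl//; last exact: (@bounded_integrable _ _ _ _ _ a^-1).
  by apply: eq_Rintegral => x _; rewrite kE lnK.
have EE : expR (b * ln a) = a `^ b by rewrite /powR gt_eqF.
have -> : a `^ (b - 1) = a `^ b / a.
  by rewrite -EE /powR gt_eqF// mulrBl mul1r expRD expRN lnK.
apply: (mulfI (lt0r_neq0 a0)); rewrite -aE.
transitivity (k (b * ln a) 0 1 * b); last first.
  by rewrite kE normr1 !mulr1 mul1r EE; field; rewrite gt_eqF.
apply: H.
- by move=> t _; exact: measurable_expcos.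
- move=> t x tr; rewrite (le_trans (normr_expcos _ _ _ (cr0 t tr)))//.
  by rewrite lerDr invrK.
- by move=> t x _; exact: is_derive_expcos_t.
- by move=> t x tr; apply: normr_expcos_derive_t;
    [rewrite invr_gt0 | exact: cr].
- by move=> t tr; apply: stable_expcos => //; exact: rpi.
- have d1 := is_derive_expcos_t c (b * ln a) (b * 0) 1.
  have := @is_derive1_comp _ (fun t => expcos c (b * ln a) t 1) (fun t =>
    b * t) 0 _ b d1.
  rewrite mulr0 => d2.
  by apply d2; apply: is_derive_eq; rewrite /GRing.scale/=; ring.
Qed.

(** At a = 1 the integrals of |x| exp (- |x|) and x exp (- |x|) coincide. Their difference has a
    nonnegative integrand, which therefore vanishes almost everywhere, and so |x| = x. *)
Lemma stable_ge0 (R : realType) (b : R) (mu : probability R R) :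
  0 < b -> b <= 1 -> one_sided_stable_law b mu -> {ae mu, forall x, 0 <= x}.
Proof.
move=> b0 b1 mus.
pose f (x : R) := (`|x| - x) * expR (- (1 * `|x|)).
have mf : measurable_fun [set: R] f.
  apply: measurable_funM; last exact: measurable_expRNM_norm.
  exact: measurable_funB.
have f0 x : 0 <= f x by rewrite mulr_ge0 ?expR_ge0// subr_ge0 ler_norm.
have i1 : mu.-integrable setT (EFin \o (fun x : R =>
  `|x| * expR (- (1 * `|x|)))).
  apply: (@bounded_integrable _ _ _ _ _ 1^-1).
    by apply: measurable_funM => //; exact: measurable_expRNM_norm.
  by move=> x; rewrite -[X in expR (- (1 * X))]normr_id normr_mul_expRN_norm.
have i2 : mu.-integrable setT (EFin \o (fun x : R => x * expR (- (1 * `|x|)))).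
  apply: (@bounded_integrable _ _ _ _ _ 1^-1).
    by apply: measurable_funM => //; exact: measurable_expRNM_norm.
  by move=> x; rewrite normr_mul_expRN_norm.
have intf : mu.-integrable setT (EFin \o f).
  have := integrableB measurableT i1 i2.
  by apply: eq_integrable => // x _; rewrite /= -EFinB /f mulrBl.
have f_eq0 : \int[mu]_x f x = 0.
  rewrite /f; under eq_Rintegral do rewrite mulrBl.
  rewrite RintegralB// (stable_laplace_derive b0 b1 mus ltr01).
  by rewrite (stable_laplace_derive_signed b0 b1 mus ltr01) subrr.
have mEf : measurable_fun [set: R] (EFin \o f) by exact/measurable_EFinP.
have : (\int[mu]_x `|(EFin \o f) x| = 0)%E.
  under eq_integral do rewrite gee0_abs ?lee_fin ?f0//=.
  by rewrite -[LHS]fineK ?integrable_fin_num// -/(Rintegral _ _ _) f_eq0.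
move=> /ae_eq_integral_abs => /(_ measurableT mEf).
apply: filterS => x /(_ Logic.I) [/eqP].
rewrite mulf_eq0 (gt_eqF (expR_gt0 _)) orbF subr_eq0 => /eqP <-.
exact: normr_ge0.
Qed.

(** An atom of mass m at 0 stays below the Laplace transform, hence below exp (- y) for all y > 0.
    For y = 1 / m this reads exp (1 / m) <= 1 / m, against 1 + x <= exp x. The lemma later keeps the
    denominator of the ratio away from 0. *)
Lemma stable_neq0 (R : realType) (b : R) (mu : probability R R) :
  0 < b -> b <= 1 -> one_sided_stable_law b mu -> {ae mu, forall x, x != 0}.
Proof.
move=> b0 b1 mus.
exists [set 0]; split => //; last by move=> x /= /negP; rewrite negbK => /eqP.
pose m := fine (mu [set 0]).
have mE : mu [set 0] = m%:E by rewrite /m fineK// fin_num_measure.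
rewrite mE; congr EFin; apply/eqP; rewrite eq_le fine_ge0// andbT leNgt.
apply/negP => m0.
have m_le y : 0 < y -> m <= expR (- y).
  move=> y0; pose a := y `^ b^-1.
  have a0 : 0 < a by rewrite powR_gt0.
  have -> : y = a `^ b by rewrite /a -powRrM mulVf ?gt_eqF// powRr1// ltW.
  rewrite -(stable_laplace b0 b1 mus a0).
  have -> : m = \int[mu]_x (\1_[set 0] x).
    by rewrite /Rintegral integral_indic// setIT.
  apply: le_Rintegral => //.
  - exact: integrable_indic.
  - apply: (@bounded_integrable _ _ _ _ _ 1);
      first exact: measurable_expRNM_norm.
    move=> x; rewrite gtr0_norm ?expR_gt0// -expR0 ler_expR oppr_le0.
    by rewrite mulr_ge0// ltW.
  - move=> x _; rewrite indicE; have [|_] := boolP (x \in _);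
      last exact: expR_ge0.
    by rewrite inE => ->; rewrite normr0 mulr0 oppr0 expR0.
have mV0 : 0 < m^-1 by rewrite invr_gt0.
have := m_le _ mV0; rewrite expRN -[leLHS]invrK lef_pV2 ?posrE ?expR_gt0//.
by have := expR_ge1Dx m^-1; lra.
Qed.

(** * Uniqueness of the characteristic function *)

Lemma bounded_fubini d1 d2 (T1 : measurableType d1) (T2 : measurableType d2)
    (R : realType) (P1 : probability T1 R) (P2 : probability T2 R)
    (f : T1 * T2 -> R) (M : R) :
  measurable_fun setT f -> (forall z, `|f z| <= M) ->
  \int[(P1 \x P2)%E]_z f z = \int[P1]_x \int[P2]_y f (x, y) /\
  \int[(P1 \x P2)%E]_z f z = \int[P2]_y \int[P1]_x f (x, y).
Proof.
move=> mf fM.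
have if1 x : P2.-integrable setT (EFin \o (fun y => f (x, y))).
  apply: (@bounded_integrable _ _ _ _ _ M) => //.
  exact: measurableT_comp.
have if2 y : P1.-integrable setT (EFin \o (fun x => f (x, y))).
  apply: (@bounded_integrable _ _ _ _ _ M) => //.
  by apply: measurableT_comp => //; exact: measurable_pair2.
have intf : (P1 \x P2)%E.-integrable setT (EFin \o f).
  pose PP : probability _ R := (P1 \x P2)%E.
  have := @bounded_integrable _ _ _ PP f M mf fM.
  exact.
split; rewrite [LHS]/Rintegral.
  rewrite -(integral12_prod_meas1 intf)/=; congr fine; apply: eq_integral =>
    x _.
  by rewrite /fubini_F/= fineK//; exact: (integrable_fin_num _ (if1 x)).
rewrite -(integral21_prod_meas1 intf)/=; congr fine; apply: eq_integral => y _.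
by rewrite /fubini_G/= fineK//; exact: (integrable_fin_num _ (if2 y)).
Qed.

(** * Integration against a density *)

Section density.
Import HBNNSimple.

(** For simple functions this is the hypothesis on level sets together with linearity; monotone
    convergence along [nnsfun_approx] does the rest. *)
Lemma ge0_integral_density d (T : measurableType d) (R : realType)
    (mu nu : {measure set T -> \bar R}) (p : T -> R) (f : T -> \bar R) :
  measurable_fun setT p -> (forall x, 0 <= p x) ->
  (forall A, measurable A -> nu A = \int[mu]_(x in A) (p x)%:E)%E ->
  measurable_fun setT f -> (forall x, 0 <= f x)%E ->
  (\int[nu]_x f x = \int[mu]_x (f x * (p x)%:E))%E.
Proof.
move=> mp p0 nuE mf f0; pose f_ := nnsfun_approx measurableT mf.
have mEp : measurable_fun setT (EFin \o p) by exact/measurable_EFinP.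
have nnE (h : {nnsfun T >-> R}) :
    (\int[nu]_x (h x)%:E = \int[mu]_x ((h x)%:E * (p x)%:E))%E.
  rewrite integralT_nnsfun sintegralE.
  under [RHS]eq_integral.
    move=> x _; rewrite fimfunE -fsumEFin// ge0_mule_fsuml; last first.
      by move=> r; rewrite EFinM nnfun_muleindic_ge0.
    over.
  rewrite ge0_integral_fsum//; last 2 first.
  - move=> r; apply: emeasurable_funM => //.
    by apply/measurable_EFinP; exact: measurableT_comp.
  - move=> r x _; apply: mule_ge0; last by rewrite lee_fin.
    by rewrite EFinM nnfun_muleindic_ge0.
  apply: eq_fsbigr => r rh.
  have r0 : 0 <= r by move/set_mem : rh => [x _ <-].
  rewrite nuE// [in RHS](eq_integral
      (fun x => r%:E * ((\1_(h @^-1` [set r]) x)%:E * (p x)%:E)))%E; last first.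
    by move=> x _; rewrite EFinM muleA.
  rewrite ge0_integralZl//; last 2 first.
  - by apply: emeasurable_funM => //; apply/measurable_EFinP.
  - by move=> x _; rewrite mule_ge0 ?lee_fin.
  congr (_ * _)%E; rewrite integral_mkcond; apply: eq_integral => x _.
  by rewrite patchE indicE; case: ifPn; rewrite ?mul1e ?mul0e.
have cvf x : (EFin \o f_^~ x) @ \oo --> f x by exact: cvg_nnsfun_approx.
transitivity (limn (fun n => \int[nu]_x (f_ n x)%:E))%E.
  rewrite -monotone_convergence//=.
  - by apply: eq_integral => x _; apply/esym/cvg_lim => //; exact: cvf.
  - by move=> n; exact/measurable_EFinP.
  - by move=> n x _; rewrite lee_fin.
  - by move=> x _ m n mn; rewrite lee_fin; exact/lefP/nd_nnsfun_approx.
under eq_fun do rewrite nnE.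
rewrite -monotone_convergence//=.
- apply: eq_integral => x _; apply/cvg_lim => //.
  by apply: cvgeMr => //; exact: cvf.
- by move=> n; apply: emeasurable_funM => //; exact/measurable_EFinP.
- by move=> n x _; rewrite mule_ge0// lee_fin.
- move=> x _ m n mn; rewrite lee_wpmul2r// lee_fin//.
  exact/lefP/nd_nnsfun_approx.
Qed.

Lemma bounded_Rintegral_density d (T : measurableType d) (R : realType)
    (mu : {measure set T -> \bar R}) (nu : probability T R) (p f : T -> R)
    (M : R) :
  measurable_fun setT p -> (forall x, 0 <= p x) ->
  (forall A, measurable A -> nu A = \int[mu]_(x in A) (p x)%:E)%E ->
  measurable_fun setT f -> (forall x, `|f x| <= M) ->
  \int[nu]_x f x = \int[mu]_x (f x * p x).
Proof.
move=> mp p0 nuE mf fM.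
have p1 : (\int[mu]_x (p x)%:E = 1)%E.
  by rewrite -[RHS](probability_setT nu) nuE.
have ip : mu.-integrable setT (EFin \o p).
  apply/integrableP; split; first exact/measurable_EFinP.
  by under eq_integral do rewrite /= ger0_norm//; rewrite p1 ltry.
have ifp : mu.-integrable setT (EFin \o (fun x => f x * p x)).
  apply: (le_integrable _ _ _ (integrableZl measurableT M ip)) => //.
    by apply/measurable_EFinP; exact: measurable_funM.
  move=> x _; rewrite lee_fin /= !normrM ler_wpM2r//.
  by rewrite (le_trans (fM x)) ?ler_norm.
(* Adding M makes the integrand nonnegative; the added constant has integral M on both sides, since
   p has total mass 1. *)
have H : \int[nu]_x (f x + M) = \int[mu]_x ((f x + M) * p x).
  congr fine; rewrite (ge0_integral_density (p := p) (mu := mu))//.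
    by apply/measurable_EFinP; exact: measurable_funD.
  by move=> x; rewrite lee_fin; have := fM x; rewrite ler_norml; lra.
have iM : nu.-integrable setT (EFin \o cst M) by exact:
  finite_measure_integrable_cst.
have fi : nu.-integrable setT (EFin \o f) by exact: bounded_integrable fM.
move: H; rewrite RintegralD// probability_Rintegral_cst.
under [X in _ = X -> _]eq_Rintegral do rewrite mulrDl.
rewrite RintegralD//; last exact: (integrableZl measurableT M ip).
by rewrite RintegralZl// [X in _ + M * X]/Rintegral p1 mulr1 => /addIr.
Qed.

End density.

Lemma exponential_lawP (R : realType) (a : R) : 0 < a ->
  exists E : probability (measurableTypeR R) R, forall A, measurable A ->
    E A = (\int[lebesgue_measure]_(x in A) (exponential_pdf a x)%:E)%E.
Proof.
move=> a0; unshelve eexists.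
  exact: [the probability _ _ of exponential_prob a].
by [].
Qed.

Lemma exponential_cos (R : realType) (a x : R)
    (E : probability (measurableTypeR R) R) : 0 < a ->
  (forall A, measurable A ->
    E A = (\int[lebesgue_measure]_(x in A) (exponential_pdf a x)%:E)%E) ->
  \int[E]_t cos (x * t) = a ^+ 2 / (a ^+ 2 + x ^+ 2).
Proof.
move=> a0 EE; pose D := a ^+ 2 + x ^+ 2.
have D0 : 0 < D by rewrite ltr_wpDr ?sqr_ge0// exprn_gt0.
have mcos : measurable_fun [set: measurableTypeR R] (fun t => cos (x * t)).
  apply: (measurableT_comp (@measurable_cos R)).
  exact: measurable_funM.
have cos1 t : `|cos (x * t)| <= 1 by exact: normr_cos_le1.
have icos : E.-integrable setT (EFin \o (fun t => cos (x * t))).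
  exact: (@bounded_integrable _ _ _ _ _ 1).
(* With 1 added the integrand 1 + cos is nonnegative, as the fundamental theorem of calculus on a
   half-line asks. The antiderivative [F] below tends to 0 at infinity. *)
apply: (@addrI _ 1); rewrite -[in LHS](probability_Rintegral_cst E 1)
  -RintegralD//; last first.
  exact: finite_measure_integrable_cst.
rewrite (@bounded_Rintegral_density _ _ _ lebesgue_measure E (exponential_pdf
  a) _ 2)//; last 4 first.
- exact: measurable_exponential_pdf.
- by move=> t; apply: exponential_pdf_ge0; exact: ltW.
- exact: measurable_funD.
- by move=> t; rewrite (le_trans (ler_normD _ _))// normr1 -[2]/(1 + 1) lerD2l.
pose f t := (1 + cos (x * t)) * (a * expR (- (a * t))).
transitivity (\int[lebesgue_measure]_(t in `[0, +oo[) f t).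
  rewrite [RHS]Rintegral_mkcond; apply: eq_Rintegral => t _.
  rewrite /exponential_pdf !patchE; case: ifPn => _; last by rewrite mulr0.
  by rewrite /f mulNr.
pose F t := - (expR (- (a * t)) * (1 + (a ^+ 2 * cos (x * t) - a * x * sin (x *
  t)) / D)).
have dF (t : R) : is_derive t 1 F (f t).
  rewrite /F /f; apply: is_derive_eq; rewrite /GRing.scale/=.
  by rewrite /D; field; rewrite gt_eqF.
rewrite (@Rintegral_ge0_continuous_FTC2y _ f F 0 0).
- by rewrite /F !mulr0 oppr0 expR0 cos0 sin0 mulr0 subr0 !mul1r mulr1 sub0r
    opprK.
- move=> t t0; rewrite mulr_ge0 ?mulr_ge0 ?expR_ge0 ?(ltW a0)//.
- apply: continuous_subspaceT => t.
  apply: differentiable_continuous; apply/derivable1_diffP.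
  by rewrite /f; exact: ex_derive.
- pose K := 1 + (a ^+ 2 + a * `|x|) / D.
  have K0 : expR (- (a * t)) * K @[t --> +oo] --> 0.
    rewrite -(mul0r K); apply: cvgM; last exact: cvg_cst.
    apply: (@cvg_comp _ _ _ (fun t => a * t) (fun z =>
      expR (- z)) _ (pinfty_nbhs R)).
      exact: gt0_cvgMry.
    exact: cvgr_expR.
  apply: norm_cvg0; apply: (@squeeze_cvgr _ _ _ _ (cst 0) _ _ _ _ _ K0);
    last exact: cvg_cst.
  apply: nearW => t; rewrite normr_ge0/= /F normrN normrM gtr0_norm ?expR_gt0//.
  rewrite ler_wpM2l ?expR_ge0// (le_trans (ler_normD _ _))// normr1 lerD2l.
  rewrite normrM [`|D^-1|]gtr0_norm ?invr_gt0// ler_wpM2r ?invr_ge0 ?(ltW D0)//.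
  rewrite (le_trans (ler_normB _ _))// lerD// normrM -[leRHS]mulr1 ler_pM//.
  + by rewrite ger0_norm// sqr_ge0.
  + by rewrite normrM gtr0_norm.
  + exact: normr_sin_le1.
- by move=> t _; exact: ex_derive.
- by apply: cvg_at_right_filter; apply: differentiable_continuous;
    apply/derivable1_diffP; exact: ex_derive.
- by move=> t _; rewrite derive1E; have [_ ->] := dF t.
Qed.

Section uniqueness.
Variable R : realType.
Implicit Types (mu nu : probability R R) (a c p q x : R).

Lemma char_fun_cosB mu c t : \int[mu]_x cos ((x - c) * t) =
  cos (c * t) * complex.Re (char_fun mu t) + sin (c * t) * complex.Im (char_fun
    mu t).
Proof.
have mcos : measurable_fun [set: R] (fun x => cos (t * x)).
  apply: (measurableT_comp (@measurable_cos R)).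
  exact: measurable_funM.
have msin : measurable_fun [set: R] (fun x => sin (t * x)).
  apply: (measurableT_comp (@measurable_sin R)).
  exact: measurable_funM.
have icos : mu.-integrable setT (EFin \o (fun x => cos (t * x))).
  apply: (@bounded_integrable _ _ _ _ _ 1) => // x.
  exact: normr_cos_le1.
have isin : mu.-integrable setT (EFin \o (fun x => sin (t * x))).
  apply: (@bounded_integrable _ _ _ _ _ 1) => // x.
  exact: normr_sin_le1.
rewrite /char_fun /= -!RintegralZl// -RintegralD//; last 2 first.
- exact: (integrableZl measurableT (cos (c * t)) icos).
- exact: (integrableZl measurableT (sin (c * t)) isin).
apply: eq_Rintegral => x _.
by rewrite mulrBl cosB [x * t]mulrC; ring.
Qed.

Lemma measurable_cauchy d (T : measurableType d) (f : T -> R) a : 0 < a ->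
  measurable_fun setT f ->
  measurable_fun setT (fun u => a ^+ 2 / (a ^+ 2 + f u ^+ 2)).
Proof.
move=> a0 mf; apply: measurable_funM => //.
apply: (measurableT_comp (@measurable_invr R)).
by apply: measurable_funD => //; exact: measurable_funX.
Qed.

Lemma cauchy_ge0 a x : 0 <= a ^+ 2 / (a ^+ 2 + x ^+ 2).
Proof. by rewrite divr_ge0 ?addr_ge0 ?sqr_ge0. Qed.

Lemma normr_cauchy a x : `|a ^+ 2 / (a ^+ 2 + x ^+ 2)| <= 1.
Proof.
rewrite ger0_norm ?cauchy_ge0//; have [->|a0] := eqVneq a 0.
  by rewrite expr0n mul0r.
by rewrite ler_pdivrMr ?mul1r ?lerDl ?sqr_ge0// ltr_wpDr ?sqr_ge0//
  exprn_even_gt0.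
Qed.

(** The Cauchy kernel at x - c is the mean of cos ((x - c) t) for t exponential with rate a. After
    exchanging the integrals, the inner one depends on the law only through its characteristic
    function. *)
Lemma eq_char_fun_cauchy mu nu a c :
  (forall t, char_fun mu t = char_fun nu t) ->
  0 < a ->
  \int[mu]_x (a ^+ 2 / (a ^+ 2 + (x - c) ^+ 2)) =
  \int[nu]_x (a ^+ 2 / (a ^+ 2 + (x - c) ^+ 2)).
Proof.
move=> munu a0; have [E EE] := exponential_lawP a0.
suff H (m : probability R R) : \int[m]_x (a ^+ 2 / (a ^+ 2 + (x - c) ^+ 2)) =
    \int[E]_t (cos (c * t) * complex.Re (char_fun m t) +
               sin (c * t) * complex.Im (char_fun m t)).
  by rewrite !H; apply: eq_Rintegral => t _; rewrite munu.
under eq_Rintegral do rewrite -(exponential_cos _ a0 EE).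
under [RHS]eq_Rintegral do rewrite -char_fun_cosB.
have mf : measurable_fun [set: R * measurableTypeR R]
    (fun z : R * measurableTypeR R => cos ((z.1 - c) * z.2)).
  apply: (measurableT_comp (@measurable_cos R)).
  by apply: measurable_funM => //; apply: measurable_funB.
have [|e1 e2] := @bounded_fubini _ _ _ _ _ m E _ 1 mf.
  by move=> z; exact: normr_cos_le1.
by rewrite -e1 e2.
Qed.

Lemma uniform_cauchy p q a x (pq : p < q) : 0 < a ->
  \int[uniform_prob pq]_c (a ^+ 2 / (a ^+ 2 + (x - c) ^+ 2)) =
  (q - p)^-1 * a * (atan ((q - x) / a) - atan ((p - x) / a)).
Proof.
move=> a0; rewrite /Rintegral integral_uniform; last 2 first.
- by apply/measurable_EFinP; apply: measurable_cauchy => //;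
    exact: measurable_funB.
- by move=> c; rewrite lee_fin cauchy_ge0.
have D0 c : 0 < a ^+ 2 + (x - c) ^+ 2 by rewrite ltr_wpDr ?sqr_ge0// exprn_gt0.
pose F c := a * atan ((c - x) / a).
have dF (c : R) : is_derive c 1 F (a ^+ 2 / (a ^+ 2 + (x - c) ^+ 2)).
  rewrite /F; apply: is_derive_eq; rewrite /GRing.scale/=.
  have -> : 1 + ((c - x) / a) ^+ 2 = (a ^+ 2 + (x - c) ^+ 2) / a ^+ 2.
    by field; rewrite gt_eqF.
  by rewrite invf_div; field; rewrite !gt_eqF.
have cF : continuous F.
  move=> c; apply: differentiable_continuous; apply/derivable1_diffP.
  exact: ex_derive.
rewrite (@continuous_FTC2 _ _ F)//.
- by rewrite /F/=; ring.
- apply: continuous_subspaceT => c.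
  apply: cvgM; first exact: cvg_cst.
  apply: cvgV; first by rewrite gt_eqF.
  apply: cvgD; first exact: cvg_cst.
  apply: (continuous_cvg _ (@exprn_continuous _ 2 _)).
  by apply: cvgB; [exact: cvg_cst | exact: cvg_id].
- split=> [c _||]; first exact: ex_derive.
  + exact/cvg_at_right_filter/cF.
  + exact/cvg_at_left_filter/cF.
- by move=> c _; rewrite derive1E; have [_ ->] := dF c.
Qed.

(** The previous equality is averaged over centres c uniform between p and q; after Fubini the
    kernel integrates to a difference of arctangents. *)
Lemma eq_char_fun_atan mu nu a p q :
  (forall t, char_fun mu t = char_fun nu t) ->
  0 < a -> p < q ->
  \int[mu]_x (atan ((q - x) / a) - atan ((p - x) / a)) =
  \int[nu]_x (atan ((q - x) / a) - atan ((p - x) / a)).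
Proof.
move=> munu a0 pq.
have k0 : (q - p)^-1 * a != 0.
  by rewrite gt_eqF// mulr_gt0// invr_gt0 subr_gt0.
suff H (m : probability R R) :
    \int[m]_x (atan ((q - x) / a) - atan ((p - x) / a)) =
    ((q - p)^-1 * a)^-1 * \int[uniform_prob pq]_c \int[m]_x (a ^+ 2 / (a ^+ 2 +
      (x - c) ^+ 2)).
  by rewrite !H; congr (_ * _); apply: eq_Rintegral => c _;
    exact: eq_char_fun_cauchy.
have mf : measurable_fun [set: R * measurableTypeR R]
    (fun z : R * measurableTypeR R => a ^+ 2 / (a ^+ 2 + (z.1 - z.2) ^+ 2)).
  by apply: measurable_cauchy => //; apply: measurable_funB.
have [|e1 e2] := @bounded_fubini _ _ _ _ _ m (uniform_prob pq) _ 1 mf.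
  by move=> z; exact: normr_cauchy.
rewrite -e2 e1.
under [in RHS]eq_Rintegral do rewrite uniform_cauchy//.
have matan r : measurable_fun [set: R] (fun x => atan ((r - x) / a)).
  apply: (measurableT_comp (continuous_measurable_fun (@continuous_atan R))).
  by apply: measurable_funM => //; exact: measurable_funB.
rewrite RintegralZl ?mulKf//; apply: (@bounded_integrable _ _ _ _ _ pi).
  exact: measurable_funB.
move=> x.
have := atan_ltpi2 ((q - x) / a); have := atan_gtNpi2 ((q - x) / a).
have := atan_ltpi2 ((p - x) / a); have := atan_gtNpi2 ((p - x) / a).
rewrite ler_norml; lra.
Qed.

(** The end point is shifted by h while the width is h^2. The shift outweighs the width, so the
    limit at x = q is pi / 2 and not 0, which fits intervals closed on the right. *)
Lemma cvg_atan_step q x :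
  atan ((q + harmonic n - x) / harmonic n ^+ 2) @[n --> \oo] -->
  (if x <= q then pi / 2 else - (pi / 2)).
Proof.
have h0 n : 0 < @harmonic R n := harmonic_gt0 n.
have hV (A : R) : \forall n \near \oo, A <= (@harmonic R n)^-1.
  near=> n; rewrite /harmonic invrK (@le_trans _ _ n%:R)//;
    last by rewrite ler_nat.
  by near: n; exact: nbhs_infty_ger.
have h1 n : @harmonic R n <= 1 by rewrite /harmonic invf_le1// ler1n.
have [xq|qx] := leP x q.
  apply: (cvg_comp _ _ _ (@cvgy_atan R)); apply/cvgryPge => A; near=> n.
  rewrite (@le_trans _ _ (harmonic n)^-1)//; first by near: n; exact: hV.
  rewrite ler_pdivlMr ?exprn_gt0// expr2 mulKf ?gt_eqF//; lra.
under eq_fun do rewrite -[X in atan X]opprK atanN -mulNr.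
(* Once h < d, and as h <= 1, the distance x - q - h exceeds d >= d h, so the argument is at least d
   / h. *)
pose d := (x - q) / 2.
have d0 : 0 < d by rewrite divr_gt0// subr_gt0.
have hd : \forall n \near \oo, @harmonic R n < d.
  by apply: cvgr_lt (@cvg_harmonic R) _ d0.
apply: cvgN; apply: (cvg_comp _ _ _ (@cvgy_atan R)); apply/cvgryPge => A;
  near=> n.
rewrite (@le_trans _ _ (d * (harmonic n)^-1))//.
  by rewrite mulrC -ler_pdivrMr//; near: n; exact: hV.
rewrite ler_pdivlMr ?exprn_gt0// expr2 mulrA mulfVK ?gt_eqF//.
rewrite (@le_trans _ _ d)//; first by rewrite ler_piMr// ltW.
have : harmonic n < d by near: n.
rewrite /d; lra.
Unshelve. all: by end_near. Qed.

(** The arctangent differences stay below pi in modulus and tend at every point to pi times the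
    indicator of ]p, q]. *)
Lemma eq_char_fun_itv mu nu p q : (forall t, char_fun mu t = char_fun nu t) ->
  mu `]p, q]%classic = nu `]p, q]%classic.
Proof.
move=> munu; have [qp|pq] := leP q p.
  by rewrite set_itv_ge ?measure0// bnd_simp -leNgt.
pose f n x := atan ((q + harmonic n - x) / harmonic n ^+ 2) -
              atan ((p + harmonic n - x) / harmonic n ^+ 2).
have matan r (a : R) : measurable_fun [set: R] (fun x => atan ((r - x) / a)).
  apply: (measurableT_comp (continuous_measurable_fun (@continuous_atan R))).
  by apply: measurable_funM => //; exact: measurable_funB.
suff H (m : probability R R) :
    \int[m]_x f n x @[n --> \oo] --> pi * fine (m `]p, q]%classic).
  have e n : \int[mu]_x f n x = \int[nu]_x f n x.
    apply: eq_char_fun_atan => //; last by rewrite ltrD2r.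
    by rewrite exprn_gt0// harmonic_gt0.
  have := H mu; under eq_fun do rewrite e.
  move=> /(cvg_unique _ (H nu))/(mulfI (lt0r_neq0 (pi_gt0 R))) e'.
  by rewrite -[LHS]fineK ?fin_num_measure// -[RHS]fineK ?fin_num_measure// e'.
have -> : pi * fine (m `]p, q]%classic) = \int[m]_x (pi * \1_(`]p, q]%classic)
  x).
  rewrite RintegralZl//; last exact: integrable_indic.
  by rewrite /Rintegral integral_indic// setIT.
apply: (@bounded_Rintegral_cvg _ _ _ _ f _ pi).
- by move=> n; exact: measurable_funB.
- move=> n x; rewrite /f.
  set u := _ / _; set v := _ / _.
  have := atan_ltpi2 u; have := atan_gtNpi2 u.
  have := atan_ltpi2 v; have := atan_gtNpi2 v.
  by rewrite ler_norml; lra.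
- move=> x; rewrite [X in _ --> X](_ : _ =
      (if x <= q then pi / 2 else - (pi / 2)) -
      (if x <= p then pi / 2 else - (pi / 2))).
    by apply: cvgB; exact: cvg_atan_step.
  rewrite indicE mem_setE in_itv/=.
  by case: (leP x p) => xp; case: (leP x q) => xq /=; lra.
Qed.

(** The intervals ]p, q] are stable under intersection and generate the Borel sets, and the
    intervals ]-n, n] exhaust the line. *)
Lemma char_fun_inj mu nu : (forall t, char_fun mu t = char_fun nu t) ->
  forall A, measurable A -> mu A = nu A.
Proof.
move=> munu A mA.
apply: (measure_unique (@ocitv R) (fun n => `]- n%:R, n%:R]%classic)) => //.
- exact: ocitvI.
- by move=> n; exact: is_ocitv.
- exact: bigcup_itvT.
- by move=> _ [[p q] _ <-]; exact: eq_char_fun_itv.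
- by move=> n; rewrite (le_lt_trans (probability_le1 _ _)) ?ltry.
Qed.

End uniqueness.

(** * The Laplace law *)

Lemma bounded_Rintegral_map d1 d2 (X : measurableType d1) (Y :
  measurableType d2)
    (R : realType) (P : probability X R) (Q : {measure set Y -> \bar R})
    (phi : X -> Y) (f : Y -> R) (M : R) :
  measurable_fun setT phi -> measurable_fun setT f -> (forall y, `|f y| <= M) ->
  (forall A, measurable A -> Q A = P (phi @^-1` A)) ->
  \int[Q]_y f y = \int[P]_x f (phi x).
Proof.
move=> mphi mf fM QP; congr fine.
rewrite (eq_measure_integral (pushforward P phi)); last first.
  by move=> A mA _; exact: QP.
rewrite integral_pushforward//; first exact/measurable_EFinP.
rewrite preimage_setT; apply: (@bounded_integrable _ _ _ _ _ M) => //.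
exact: measurableT_comp.
Qed.

Section laplace.
Variables (R : realType) (mu : probability R R).
Hypothesis mu_laplace : laplace_law mu.

Lemma laplace_pdf_ge0 (x : R) : 0 <= laplace_pdf x.
Proof. by rewrite divr_ge0 ?expR_ge0. Qed.

Lemma continuous_laplace_pdf : continuous (@laplace_pdf R).
Proof.
move=> x; apply: cvgM; last exact: cvg_cst.
apply: (continuous_cvg _ (@continuous_expR R _)); apply: cvgN.
exact: norm_continuous.
Qed.

(** The density is even, so the law is invariant under negation and the integral of an odd function
    equals its own opposite. *)
Lemma laplace_sin t : \int[mu]_x sin (t * x) = 0.
Proof.
have msin : measurable_fun [set: R] (fun x => sin (t * x)).
  apply: (measurableT_comp (@measurable_sin R)).
  exact: measurable_funM.
have sin1 x : `|sin (t * x)| <= 1 by exact: normr_sin_le1.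
have isin : mu.-integrable setT (EFin \o (fun x => sin (t * x))).
  exact: (@bounded_integrable _ _ _ _ _ 1).
suff : \int[mu]_x sin (t * x) = - \int[mu]_x sin (t * x) by lra.
rewrite [LHS](@bounded_Rintegral_map _ _ _ _ _ mu mu -%R _ 1)//.
  under eq_Rintegral do rewrite mulrN sinN -mulN1r.
  by rewrite RintegralZl// mulN1r.
move=> A mA.
have mNA : measurable (-%R @^-1` A : set R).
  by rewrite -[X in measurable X]setTI; exact: (@measurable_funN _ _ _ setT id).
rewrite (mu_laplace mNA); apply: (etrans (mu_laplace mA)).
rewrite (eq_measure_integral (pushforward lebesgue_measure (-%R : R ->
  measurableTypeR R))); last first.
  by move=> B mB _; rewrite -[LHS]lebesgue_measureN.
rewrite ge0_integral_pushforward//.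
- by apply: eq_integral => x _; rewrite /= /laplace_pdf normrN.
- apply/measurable_EFinP; apply: measurable_funTS.
  exact: continuous_measurable_fun continuous_laplace_pdf.
- by move=> x _; rewrite lee_fin laplace_pdf_ge0.
Qed.

(** By evenness the integral folds onto the half-line, where twice the density is that of the
    exponential law of rate 1. As before, 1 is added for nonnegativity. *)
Lemma laplace_cos t : \int[mu]_x cos (t * x) = (1 + t ^+ 2)^-1.
Proof.
have mcos d (T : measurableType d) (f : T -> R) : measurable_fun setT f ->
    measurable_fun [set: T] (fun x => cos (t * f x)).
  move=> mf; apply: (measurableT_comp (@measurable_cos R)).
  exact: measurable_funM.
have cos1 x : `|cos (t * x)| <= 1 by exact: normr_cos_le1.
pose T2 : measurableType _ := measurableTypeR R.
have mid : @measurable_fun _ _ R T2 setT id by [].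
pose X : {mfun R >-> T2} := @mfun_Sub _ _ R T2 id (mem_set mid).
(* The same law on [measurableTypeR R], the type on which the exponential law is stated. *)
pose nu : probability (measurableTypeR R) R := distribution mu X.
have mp : measurable_fun [set: measurableTypeR R] (@laplace_pdf R).
  exact: continuous_measurable_fun continuous_laplace_pdf.
have [E EE] := exponential_lawP (@ltr01 R).
have nuE : forall A, measurable A ->
    nu A = (\int[lebesgue_measure]_(x in A) (laplace_pdf x)%:E)%E.
  by move=> A mA; exact: mu_laplace.
have -> : \int[mu]_x cos (t * x) = \int[nu]_x cos (t * x).
  rewrite [RHS](@bounded_Rintegral_map _ _ _ _ _ mu nu id _ 1)//.
  exact: mcos.
have H (p : R -> R) (m : probability (measurableTypeR R) R) :
    measurable_fun [set: measurableTypeR R] p -> (forall x, 0 <= p x) ->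
    (forall A, measurable A ->
      m A = \int[lebesgue_measure]_(x in A) (p x)%:E)%E ->
    1 + \int[m]_x cos (t * x) =
    fine (\int[lebesgue_measure]_x ((1 + cos (t * x)) * p x)%:E)%E.
  move=> mp' p0 mE; rewrite -[in LHS](probability_Rintegral_cst m 1)
    -RintegralD//; last 2 first.
  - exact: finite_measure_integrable_cst.
  - by apply: (@bounded_integrable _ _ _ _ _ 1) => //; exact: mcos.
  rewrite (@bounded_Rintegral_density _ _ _ lebesgue_measure m p _ 2)//.
    by apply: measurable_funD => //; exact: mcos.
  by move=> x; rewrite (le_trans (ler_normD _ _))// normr1 -[2]/(1 + 1) lerD2l.
apply: (@addrI _ 1); rewrite (H (@laplace_pdf R))//;
  last exact: laplace_pdf_ge0.
rewrite -[(1 + t ^+ 2)^-1]mul1r -(expr1n _ 2) -(exponential_cos t ltr01 EE).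
rewrite expr1n (H (exponential_pdf 1))//; last 2 first.
- exact: measurable_exponential_pdf.
- by move=> x; apply: exponential_pdf_ge0.
have cc : continuous (fun x : R => (1 + cos (t * x)) * laplace_pdf x).
  move=> x; apply: cvgM; last exact: continuous_laplace_pdf.
  apply: cvgD; first exact: cvg_cst.
  apply: (continuous_cvg _ (@continuous_cos R _)).
  by apply: cvgM; [exact: cvg_cst | exact: cvg_id].
have ge0 x : 0 <= 1 + cos (t * x) by have := cos_geN1 (t * x); lra.
have ge0' x : 0 <= (1 + cos (t * x)) * laplace_pdf x by rewrite mulr_ge0
  ?laplace_pdf_ge0.
have ev : (fun x : R => (1 + cos (t * x)) * laplace_pdf x) =1
    (fun x : R => (1 + cos (t * x)) * laplace_pdf x) \o -%R.
  by move=> x /=; rewrite mulrN cosN /laplace_pdf normrN.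
rewrite (ge0_symfun_integralT ge0' cc ev).
congr fine; rewrite -ge0_integralZl//; last 3 first.
- rewrite -set_itvcy//.
- apply/measurable_EFinP; apply: measurable_funTS.
  exact: continuous_measurable_fun cc.
- by move=> x _; rewrite lee_fin.
rewrite integral_mkcond; apply: eq_integral => x _.
rewrite patchE /exponential_pdf patchE -set_itvcy; case: ifPn => x0;
  last by rewrite mulr0.
rewrite -EFinM; congr EFin; rewrite /laplace_pdf ger0_norm.
  by rewrite mulN1r mul1r; field.
by move: x0; rewrite inE/= in_itv/= andbT.
Qed.

End laplace.

(** * Joint law of independent variables *)

Lemma mscale_product_measure d1 d2 (T1 : measurableType d1)
    (T2 : measurableType d2) (R : realType) (k : {nonneg R})
    (m1 : {measure set T1 -> \bar R}) (m2 : {sigma_finite_measure set T2 ->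
      \bar R})
    (A : set (T1 * T2)) : measurable A ->
  (mscale k m1 \x m2)%E A = (k%:num%:E * (m1 \x m2) A)%E.
Proof.
move=> mA; rewrite /product_measure1 ge0_integral_mscale//.
exact: measurable_fun_xsection.
Qed.

(** Uniqueness of product measures is used twice: for rectangles of a set of the line with a set of
    the plane, then, with the event on X fixed, for rectangles in the plane. *)
Lemma independent3_law d (T : measurableType d) (R : realType)
    (P : probability T R) (X Y Z : {RV P >-> R}) : independent3 P X Y Z ->
  forall A, measurable A ->
  (distribution P X \x (distribution P Y \x distribution P Z))%E A =
  P ((fun w => (X w, (Y w, Z w))) @^-1` A).
Proof.
move=> ind; pose YZ w := (Y w, Z w).
have mYZ : measurable_fun setT YZ by exact: measurable_fun_pair.
have mXYZ : measurable_fun setT (fun w =>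
  (X w, YZ w)) by exact: measurable_fun_pair.
pose Q : {measure set (R * (R * R)) -> \bar R} := pushforward P (fun w =>
  (X w, YZ w)).
move=> C mC; rewrite -[RHS]/(Q mXYZ C).
pose YZlaw : probability (R * R)%type R := (distribution P Y \x distribution P
  Z)%E.
apply: (@product_measure_unique _ _ _ _ _ (distribution P X) YZlaw (Q mXYZ)) =>
  // {C mC} A B mA mB.
have mXA : measurable (X @^-1` A) by rewrite -[X in measurable X]setTI;
  exact: measurable_funP.
pose k : {nonneg R} := NngNum (fine_ge0 (measure_ge0 P (X @^-1` A))).
have kE : k%:num%:E = P (X @^-1` A) by rewrite /= fineK// fin_num_measure.
(* The law of (Y, Z) on the event that X lies in A. It is again a product once the law of Y is
   scaled by the probability [k] of that event. *)
pose m' : {measure set (R * R) -> \bar R} := pushforward (mrestr P mXA) YZ.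
transitivity (m' mYZ B).
  transitivity (P (YZ @^-1` B `&` X @^-1` A)) => //; rewrite setIC.
  by congr (P _).
pose m1 := mscale k (distribution P Y).
rewrite -(@product_measure_unique _ _ _ _ _ m1 (distribution P Z) (m' mYZ))//.
  by rewrite mscale_product_measure// kE.
move=> C D mC mD; rewrite /m1 /mscale kE.
transitivity (P (YZ @^-1` (C `*` D) `&` X @^-1` A)) => //; rewrite setIC.
have -> : X @^-1` A `&` YZ @^-1` (C `*` D) = X @^-1` A `&` Y @^-1` C `&` Z
  @^-1` D.
  by apply/seteqP; split=> w /=; [move=> [? []] | move=> [[]]].
by rewrite ind//; congr (_ * _)%E; congr (_ * _)%E.
Qed.

(** * The ratio of two stable variables *)

(** Writes the ratio y / q as an integral of exponentials, in which independent summands of q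
    separate. The lower end d leaves a damping factor. *)
Lemma integral_expRN_from (R : realType) (d q y : R) : 0 <= y -> y <= q ->
  (\int[lebesgue_measure]_(u in `[d, +oo[) (y * expR (- (u * q)))%:E =
   (y / q * expR (- (d * q)))%:E)%E.
Proof.
move=> y0 yq; have : 0 <= q by exact: le_trans yq.
rewrite le_eqVlt => /predU1P[q0|q0].
  (* For q = 0 also y = 0, and both sides vanish since 0 / 0 is 0. *)
  have -> : y = 0 by apply/eqP; rewrite eq_le y0 q0 yq.
  by rewrite !mul0r; apply: integral0_eq => u _; rewrite mul0r.
pose F u := - (y / q * expR (- (u * q))).
have dF (u : R) : is_derive u 1 F (y * expR (- (u * q))).
  rewrite /F; apply: is_derive_eq; rewrite /GRing.scale/=.
  by field; rewrite gt_eqF.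
have cF : continuous F.
  move=> u; apply: differentiable_continuous; apply/derivable1_diffP.
  exact: ex_derive.
rewrite (@ge0_continuous_FTC2y _ _ F d 0).
- by rewrite -EFinB sub0r /F opprK.
- by move=> u _; rewrite mulr_ge0// expR_ge0.
- apply: continuous_subspaceT => u.
  apply: differentiable_continuous; apply/derivable1_diffP.
  exact: ex_derive.
- rewrite -oppr0 -(mulr0 (y / q)); apply: cvgN; apply: cvgMr.
  apply: (@cvg_comp _ _ _ (fun u => u * q) (fun z =>
    expR (- z)) _ (pinfty_nbhs R)).
    exact: gt0_cvgMly.
  exact: cvgr_expR.
- by move=> u _; exact: ex_derive.
- exact/cvg_at_right_filter/cF.
- by move=> u _; rewrite derive1E; have [_ ->] := dF u.
Qed.

Lemma cvgy_powR (R : realType) (b : R) : 0 < b -> u `^ b @[u --> +oo] --> +oo.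
Proof.
move=> b0; apply/cvgryPge => A; near=> u.
have u0 : 0 <= u by near: u; exact: nbhs_pinfty_ge.
rewrite (le_trans (ler_norm A))//.
have -> : `|A| = (`|A| `^ b^-1) `^ b.
  by rewrite -powRrM mulVf ?gt_eqF// powRr1.
apply: ge0_ler_powR; rewrite ?nnegrE ?powR_ge0// ?(ltW b0)//.
Unshelve. all: by end_near. Qed.

(** Up to a constant the integrand is the derivative of exp (- k u^b). For b < 1 the factor u^(b -
    1) is singular at 0, which is why the integrals start at d > 0. *)
Lemma integral_weibull_from (R : realType) (b d k : R) : 0 < b -> 0 < d ->
  0 < k ->
  (\int[lebesgue_measure]_(u in `[d, +oo[) (b * u `^ (b - 1) * expR (- (k * u
    `^ b)))%:E =
   (k^-1 * expR (- (k * d `^ b)))%:E)%E.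
Proof.
move=> b0 d0 k0.
pose F u := - (k^-1 * expR (- (k * u `^ b))).
have dF (u : R) : 0 < u ->
  is_derive u 1 F (b * u `^ (b - 1) * expR (- (k * u `^ b))).
  move=> u0; have d1 := is_derive1_powR b u0.
  rewrite /F; apply: is_derive_eq; rewrite /GRing.scale/=.
  by field; rewrite gt_eqF.
rewrite (@ge0_continuous_FTC2y _ _ F d 0).
- by rewrite -EFinB sub0r /F opprK.
- by move=> u _; rewrite mulr_ge0 ?expR_ge0// mulr_ge0 ?powR_ge0// ltW.
- apply: derivable_within_continuous => u; rewrite in_itv/= andbT => du.
  have u0 : 0 < u by exact: lt_le_trans du.
  have d1 := is_derive1_powR b u0; have d2 := is_derive1_powR (b - 1) u0.
  exact: ex_derive.
- rewrite -oppr0 -(mulr0 k^-1); apply: cvgN; apply: cvgMr.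
  apply: (@cvg_comp _ _ _ (fun u => k * u `^ b) (fun z =>
    expR (- z)) _ (pinfty_nbhs R)).
    exact: (cvg_comp _ _ (cvgy_powR b0) (gt0_cvgMry k0 cvg_id)).
  exact: cvgr_expR.
- by move=> u du; have [] := dF u (lt_trans d0 du).
- apply: cvg_at_right_filter; apply: differentiable_continuous;
    apply/derivable1_diffP.
  by have [] := dF d d0.
- move=> u; rewrite in_itv/= andbT => du.
  by rewrite derive1E; have [_ ->] := dF u (lt_trans d0 du).
Qed.

Section ratio.
Variables (R : realType) (b : R) (mu nu : probability R R).
Hypotheses (b0 : 0 < b) (b1 : b <= 1).
Hypotheses (mu_stable : one_sided_stable_law b mu).
Hypotheses (nu_stable : one_sided_stable_law b nu).
Variables (c : R).
Hypothesis c0 : 0 < c.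

Let m : probability (R * R)%type R := (mu \x nu)%E.
(** Absolute values make the bounds below hold everywhere; almost surely they change nothing, by
    [stable_ge0]. *)
Let q (z : R * R) : R := `|z.2| + c * `|z.1|.

Let q_ge0 z : 0 <= q z.
Proof. by rewrite addr_ge0// mulr_ge0// ltW. Qed.

Let le_q z : `|z.2| <= q z.
Proof. by rewrite lerDl mulr_ge0// ltW. Qed.

Let mq : measurable_fun setT q.
Proof.
apply: measurable_funD; first exact: measurableT_comp.
by apply: measurable_funM => //; exact: measurableT_comp.
Qed.

Let measurable_expRq d (T : measurableType d) (f g : T -> R) :
  measurable_fun setT f -> measurable_fun setT g ->
  measurable_fun setT (fun x => expR (- (f x * g x))).
Proof.
move=> mf mg; apply: measurableT_comp => //; apply: measurableT_comp => //.
exact: measurable_funM.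
Qed.

Let ratio_le1 z : `|z.2| / q z <= 1.
Proof.
have := q_ge0 z; rewrite le_eqVlt => /predU1P[<-|q0];
  first by rewrite invr0 mulr0.
by rewrite ler_pdivrMr// mul1r.
Qed.

Let measurable_ratio : measurable_fun setT (fun z : R * R => `|z.2| / q z).
Proof.
apply: measurable_funM; first exact: measurableT_comp.
exact: (measurableT_comp (@measurable_invr R)).
Qed.

(** The exponential of the sum factors, leaving the differentiated transform of one law at u and the
    transform of the other at u c; the exponents u^b and (u c)^b add up. *)
Lemma stable_mixture u : 0 < u ->
  \int[m]_z (`|z.2| * expR (- (u * q z))) =
  b * u `^ (b - 1) * expR (- ((1 + c `^ b) * u `^ b)).
Proof.
move=> u0.
have [||_ ->] := @bounded_fubini _ _ _ _ _ mu nu (fun z : R * R =>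
  `|z.2| * expR (- (u * q z))) u^-1.
- by apply: measurable_funM; [exact: measurableT_comp|exact: measurable_expRq].
- move=> z; apply: le_trans (normr_mul_expRN_norm `|z.2| u0).
  rewrite !normrM ler_wpM2l// !(gtr0_norm (expR_gt0 _)) ler_expR lerN2 normr_id.
  by rewrite ler_wpM2l ?(ltW u0).
have uc0 : 0 < u * c by rewrite mulr_gt0.
transitivity (\int[nu]_y (`|y| * expR (- (u * `|y|)) * expR (- ((u * c) `^
  b)))).
  apply: eq_Rintegral => y _; rewrite -(stable_laplace b0 b1 mu_stable uc0).
  rewrite -RintegralZl//; last first.
    apply: (@bounded_integrable _ _ _ _ _ 1);
      first exact: measurable_expRNM_norm.
    move=> x; rewrite gtr0_norm ?expR_gt0// -expR0 ler_expR oppr_le0.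
    by rewrite mulr_ge0// ltW.
  apply: eq_Rintegral => x _; rewrite /q/= -mulrA -expRD; congr (_ * expR _);
    ring.
rewrite RintegralZr//; last first.
  apply: (@bounded_integrable _ _ _ _ _ u^-1).
    by apply: measurable_funM => //; exact: measurable_expRNM_norm.
  by move=> y; rewrite -[X in expR (- (u * X))]normr_id;
    exact: normr_mul_expRN_norm.
rewrite (stable_laplace_derive b0 b1 nu_stable u0) -[LHS]mulrA -expRD.
congr (_ * expR _); rewrite powRM ?ltW//; ring.
Qed.

(** Tonelli on u >= d: integrating first in u gives the damped ratio, and integrating first in z
    gives the Weibull integrand of [stable_mixture]. *)
Lemma stable_ratio_damped d : 0 < d ->
  \int[m]_z (`|z.2| / q z * expR (- (d * q z))) =
  (1 + c `^ b)^-1 * expR (- ((1 + c `^ b) * d `^ b)).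
Proof.
move=> d0.
pose D : set (measurableTypeR R) := `[d, +oo[%classic.
have mD : measurable D by exact: measurable_itv.
pose f (w : (R * R) * measurableTypeR R) : \bar R :=
  (`|w.1.2| * expR (- (w.2 * q w.1)) * \1_D w.2)%:E.
have mf : measurable_fun setT f.
  apply/measurable_EFinP; apply: measurable_funM; last first.
    exact: (measurableT_comp (measurable_indic mD) measurable_snd).
  apply: measurable_funM.
    apply: measurableT_comp => //.
    exact: (measurableT_comp measurable_snd measurable_fst).
  by apply: measurable_expRq => //; exact: measurableT_comp.
have f0 w : (0 <= f w)%E by rewrite lee_fin mulr_ge0// mulr_ge0// expR_ge0.
have H := fubini_tonelli (m1 := m) (m2 := lebesgue_measure) f mf f0.
have H1 z : (\int[lebesgue_measure]_u f (z, u) =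
    (`|z.2| / q z * expR (- (d * q z)))%:E)%E.
  rewrite -integral_expRN_from// [RHS]integral_mkcond; apply: eq_integral =>
    u _.
  rewrite patchE /f indicE/= /D.
  by case: ifPn => _; rewrite ?mulr1 ?mulr0.
have H2 u : (\int[m]_z f (z, u) =
    (((fun u => (b * u `^ (b - 1) * expR (- ((1 + c `^ b) * u `^ b)))%:E)
      \_ `[d, +oo[) u))%E.
  rewrite patchE /f /= indicE /D; case: ifPn => ud; last first.
    by apply: integral0_eq => z _; rewrite mulr0.
  have u0 : 0 < u.
    by move: ud; rewrite inE/= in_itv/= andbT; exact: lt_le_trans.
  rewrite -stable_mixture// /Rintegral fineK; last first.
    apply: integrable_fin_num => //;
      apply: (@bounded_integrable _ _ _ _ _ u^-1).
      by apply: measurable_funM;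
        [exact: measurableT_comp|exact: measurable_expRq].
    move=> z; apply: le_trans (normr_mul_expRN_norm `|z.2| u0).
    rewrite !normrM ler_wpM2l//
      !(gtr0_norm (expR_gt0 _)) ler_expR lerN2 normr_id.
    by rewrite ler_wpM2l ?(ltW u0).
  by apply: eq_integral => z _; rewrite mulr1.
rewrite /Rintegral; under eq_integral do rewrite -H1.
rewrite H; under eq_integral do rewrite H2.
rewrite -integral_mkcond integral_weibull_from//.
by rewrite ltr_pwDl// powR_ge0.
Qed.

Lemma stable_ratio : \int[m]_z (`|z.2| / q z) = (1 + c `^ b)^-1.
Proof.
(* The damping is removed by d -> 0 along [harmonic], with dominating constant 1. *)
have H : \int[m]_z (`|z.2| / q z * expR (- (harmonic n * q z))) @[n --> \oo] -->
    \int[m]_z (`|z.2| / q z).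
  apply: (@bounded_Rintegral_cvg _ _ _ _
    (fun n (z : R * R) => `|z.2| / q z * expR (- (harmonic n * q z))) _ 1).
  - by move=> n; apply: measurable_funM => //; exact: measurable_expRq.
  - move=> n z; rewrite normrM -[leRHS]mulr1 ler_pM//.
      by rewrite ger0_norm// divr_ge0.
    rewrite gtr0_norm ?expR_gt0// -expR0 ler_expR oppr_le0 mulr_ge0//.
    exact: harmonic_ge0.
  - move=> z; rewrite -[X in _ --> X]mulr1 -expR0 -oppr0 -(mul0r (q z)).
    apply: cvgMr; apply: (continuous_cvg _ (@continuous_expR R _)).
    by apply: cvgN; apply: cvgM; [exact: cvg_harmonic | exact: cvg_cst].
have E : (fun n => \int[m]_z (`|z.2| / q z * expR (- (harmonic n * q z)))) =
    (fun n => (1 + c `^ b)^-1 * expR (- ((1 + c `^ b) * harmonic n `^ b))).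
  by apply/funext => n; rewrite -stable_ratio_damped// harmonic_gt0.
move: H; rewrite E => H; apply: (cvg_unique _ H) => //.
have e : (1 + c `^ b)^-1 = (1 + c `^ b)^-1 * expR (- ((1 + c `^ b) * 0)).
  by rewrite mulr0 oppr0 expR0 mulr1.
rewrite /= [X in _ --> X]e.
apply: cvgMr; apply: (continuous_cvg _ (@continuous_expR R _)).
apply: cvgN; apply: cvgMr.
have /cvg_at_rightP := powR_cvg0 b0.
apply; split; [by move=> n; exact: harmonic_gt0 | exact: cvg_harmonic].
Qed.

End ratio.

(** * The characteristic function of the mixture *)

Lemma product_stable_gt0 (R : realType) (b : R) (mu nu : probability R R) :
  0 < b -> b <= 1 -> one_sided_stable_law b mu -> one_sided_stable_law b nu ->
  {ae (mu \x nu)%E, forall z, 0 <= z.1 /\ 0 < z.2}.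
Proof.
move=> b0 b1 mus nus.
have mx : measurable [set x : R | x < 0] by rewrite -set_itvNyo.
have my : measurable [set y : R | y <= 0] by rewrite -set_itvNyc.
have x0 : mu [set x | x < 0] = 0%E.
  apply: measure_negligible => //.
  apply: negligibleS (stable_ge0 b0 b1 mus) => x /= x0; apply/negP.
  by rewrite -ltNge.
have y0 : nu [set y | y <= 0] = 0%E.
  apply: measure_negligible => //.
  have := negligibleU (stable_ge0 b0 b1 nus) (stable_neq0 b0 b1 nus).
  apply: negligibleS => y /= y0.
  have [->|yN0] := eqVneq y 0; first by right; apply/negP; rewrite negbK.
  by left; apply/negP; rewrite -ltNge lt_neqAle yN0.
exists ([set x | x < 0] `*` setT `|` setT `*` [set y | y <= 0]); split.
- by apply: measurableU; exact: measurableX.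
- apply: null_set_setU; [exact: measurableX | exact: measurableX | |].
    by rewrite [LHS]product_measure1E// [X in (X * _)%E]x0 mul0e.
  by rewrite [LHS]product_measure1E// [X in (_ * X)%E]y0 mule0.
- move=> z /=; have [x0'|] := ltP z.1 0; first by left.
  move=> z1 nz; right; split => //=; rewrite leNgt; apply/negP => z2.
  exact: nz.
Qed.

Lemma ae_eq_Rintegral d (T : measurableType d) (R : realType)
    (P : {measure set T -> \bar R}) (f g : T -> R) :
  measurable_fun setT f -> measurable_fun setT g ->
  {ae P, forall x, f x = g x} -> \int[P]_x f x = \int[P]_x g x.
Proof.
move=> mf mg fg; congr fine; apply: ae_eq_integral => //.
- exact/measurable_EFinP.
- exact/measurable_EFinP.
- by apply: filterS fg => x -> _.
Qed.

Lemma measurable_sqrt_quotient (R : realType) :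
  measurable_fun setT (fun z : R * R => Num.sqrt (z.1 * z.2^-1)).
Proof.
apply: (measurableT_comp (@measurable_sqrtr R)); apply: measurable_funM => //.
exact: (measurableT_comp (@measurable_invr R)).
Qed.

(** For x >= 0 and y > 0, hence almost surely, 1 / (1 + t^2 x / y) = y / (y + t^2 x), which is the
    ratio of [stable_ratio] with c = t^2. That lemma asks c > 0, so t = 0 is treated apart. *)
Lemma stable_quotient_cauchy (R : realType) (b : R) (mu nu :
  probability R R) (t : R) :
  0 < b -> b <= 1 -> one_sided_stable_law b mu -> one_sided_stable_law b nu ->
  \int[(mu \x nu)%E]_z (1 + (t * Num.sqrt (z.1 * z.2^-1)) ^+ 2)^-1 =
  (1 + (t ^+ 2) `^ b)^-1.
Proof.
move=> b0 b1 mus nus; have [->|t0] := eqVneq t 0.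
  rewrite expr0n/= powR0 ?gt_eqF//
    addr0 invr1 -[RHS](probability_Rintegral_cst (mu \x nu)%E).
  by apply: eq_Rintegral => z _; rewrite mul0r expr0n addr0 invr1.
have c0 : 0 < t ^+ 2 by rewrite exprn_even_gt0.
rewrite -(stable_ratio b0 b1 mus nus c0); apply: ae_eq_Rintegral.
- apply: (measurableT_comp (@measurable_invr R)); apply: measurable_funD => //.
  apply: measurable_funX; apply: measurable_funM => //.
  exact: measurable_sqrt_quotient.
- apply: measurable_funM; first exact: measurableT_comp.
  apply: (measurableT_comp (@measurable_invr R)); apply: measurable_funD.
    exact: measurableT_comp.
  by apply: measurable_funM => //; exact: measurableT_comp.
- apply: filterS (product_stable_gt0 b0 b1 mus nus) => -[x y]/= [x0 y0].
  rewrite exprMn sqr_sqrtr ?mulr_ge0 ?invr_ge0 ?(ltW y0)//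
    (ger0_norm x0) (gtr0_norm y0).
  have D0 : 0 < y + t ^+ 2 * x by rewrite ltr_pwDl// mulr_ge0// ltW.
  by field; rewrite !gt_eqF.
Qed.

Theorem theorem2 (R : realType) (alpha : R)
    (alpha_gt0 : 0 < alpha) (alpha_le2 : alpha <= 2)
    (d1 : measure_display) (T1 : measurableType d1) (P1 : probability T1 R)
    (L : {RV P1 >-> R})
    (d2 : measure_display) (T2 : measurableType d2) (P2 : probability T2 R)
    (Lambda S S' : {RV P2 >-> R}) :
  linnik_law alpha (distribution P1 L) ->
  laplace_law (distribution P2 Lambda) ->
  one_sided_stable_law (alpha / 2) (distribution P2 S) ->
  one_sided_stable_law (alpha / 2) (distribution P2 S') ->
  independent3 P2 Lambda S S' ->
  eq_in_distribution P1 P2 L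
    (Lambda \* (Num.sqrt \o (S \* (GRing.inv \o S')))).
Proof.
move=> Llaw Lambdalaw Slaw S'law ind.
pose lam : probability R R := distribution P2 Lambda.
pose mu : probability R R := distribution P2 S.
pose nu : probability R R := distribution P2 S'.
pose W (z : R * R) := Num.sqrt (z.1 * z.2^-1).
have mW : measurable_fun setT W by exact: measurable_sqrt_quotient.
set Y : {RV P2 >-> R} := (Lambda \* _).
pose munu : probability (R * R)%type R := (mu \x nu)%E.
pose Q : probability (R * (R * R))%type R := (lam \x munu)%E.
have mY : measurable_fun setT (fun w : R * (R * R) => w.1 * W w.2).
  by apply: measurable_funM => //; exact: measurableT_comp.
have b0 : 0 < alpha / 2 by rewrite divr_gt0.
have b1 : alpha / 2 <= 1 by rewrite ler_pdivrMr// mul1r.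
(* The law of [Y] is an image of the product law of [independent3_law]. The Laplace factor is
   integrated first, with the scale W z held constant. *)
have law (f : R -> R) : measurable_fun setT f -> (forall x, `|f x| <= 1) ->
    \int[distribution P2 Y]_y f y =
    \int[munu]_z \int[lam]_l f (l * W z).
  move=> mf f1.
  rewrite (@bounded_Rintegral_map _ _ _ _ _ P2 _ Y f 1)//.
  have mfY : measurable_fun setT (fun w : R * (R * R) => f (w.1 * W w.2)).
    exact: measurableT_comp.
  have [//|_ <-] := @bounded_fubini _ _ _ _ _ lam munu _ 1 mfY.
  rewrite [RHS](@bounded_Rintegral_map _ _ _ _ _ P2 Q
    (fun w => (Lambda w, (S w, S' w))) (fun w => f (w.1 * W w.2)) 1)//.
    by apply: measurable_fun_pair => //; exact: measurable_fun_pair.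
  by move=> A mA; exact: independent3_law.
apply: char_fun_inj => t; rewrite Llaw /char_fun law; last 2 first.
- apply: (measurableT_comp (@measurable_cos R)).
  exact: measurable_funM.
- by move=> x; exact: normr_cos_le1.
rewrite law; last 2 first.
- apply: (measurableT_comp (@measurable_sin R)).
  exact: measurable_funM.
- by move=> x; exact: normr_sin_le1.
have -> : \int[munu]_z \int[lam]_l sin (t * (l * W z)) = 0.
  rewrite -[RHS](probability_Rintegral_cst munu 0); apply: eq_Rintegral => z _.
  rewrite -(laplace_sin Lambdalaw (t * W z)); apply: eq_Rintegral => l _.
  by rewrite [l * _]mulrC mulrA.
have -> : \int[munu]_z \int[lam]_l cos (t * (l * W z)) = (1 + `|t| `^ alpha)^-1.
  (* Conditionally on the scale, [laplace_cos] at t W z gives the integrand of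
     [stable_quotient_cauchy], whose value is expressed through t^2. *)
  have -> : `|t| `^ alpha = (t ^+ 2) `^ (alpha / 2).
    rewrite -[t ^+ 2]real_normK ?num_real// -powR_mulrn// -powRrM.
    by congr (_ `^ _); field.
  rewrite -(stable_quotient_cauchy t b0 b1 Slaw S'law);
    apply: eq_Rintegral => z _.
  rewrite -(laplace_cos Lambdalaw); apply: eq_Rintegral => l _.
  by rewrite [l * _]mulrC mulrA.
by [].
Qed.
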